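(* There exists a non-flat Hermitian Yang--Mills connection $\widetilde A$ on the trivial $\mathbb C^2$-bundle (with structure group $SU(2)$) over the nearly Kähler manifold $S^3\times S^3$ such that, for every $C>-3$, the $G_2$-instanton $$A_C=f_C\,A_1,\qquad f_C=\frac{2}{3(1+|a|^2)+C(1+|a|^2)^{1/3}},\qquad A_1=\mathrm{Im}(a\bar\alpha),$$ on the Bryant--Salamon manifold $X$ (the total space of the spinor bundle of $S^3$) is asymptotic to the pull-back of $\widetilde A$ to $\mathbb R^+\times(S^3\times S^3)$.
   Context: Conventions. $\mathbb{H}$ denotes the quaternions, $S^3=SU(2)$ the unit quaternions, $\mathrm{Im}\,\mathbb H\cong\mathfrak{su}(2)$. Products and powers of $\mathbb H$-valued forms (e.g. $\omega^2$, $(\theta_3-\phi)^3$) are wedge products combined with quaternion multiplication. Upper multi-indices denote wedge products of components. The curvature constant of the base $S^3$ is normalized to $\kappa=1$. The manifold. $X=(S^3\times S^3\times\mathbb H)/S^3$, where $q\in S^3$ acts by $(g_1,g_2,v)\mapsto(g_1q,g_2q,vq)$. Let $\theta_i=g_i^{-1}dg_i$ ($i=1,2$), $\phi=\frac12(\theta_1+\theta_2)$, $\omega=\theta_1-\theta_2=\omega^1i+\omega^2j+\omega^3k$, so $d\phi=-\phi\wedge\phi-\frac14\omega\wedge\omega$. Let $a$ be the projection to $\mathbb H$ and $\alpha=da-a\phi$. Forms invariant under the $S^3$-action and vanishing on vectors tangent to its orbits are identified with forms on the quotient; $|a|^2$ and $A_1=\mathrm{Im}(a\bar\alpha)$ are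 such. The connections $d+A_C$ on the trivial $\mathbb C^2$-bundle over $X$ are $G_2$-instantons for the Bryant--Salamon metric. The end. Away from the zero section write $a=|a|g_3$ with $g_3\in S^3$, let $\theta_3=g_3^{-1}dg_3$ and $\rho=3(1+|a|^2)^{1/3}>3$. This identifies $X\setminus\{a=0\}$ with $(3,\infty)\times(S^3\times S^3)\subset\mathbb{R}^+\times(S^3\times S^3)$, where $S^3\times S^3=(S^3\times S^3\times S^3)/S^3$ (diagonal right action). The Bryant--Salamon metric is asymptotic as $\rho\to\infty$ to the cone $g_{con}=d\rho^2+\rho^2g$, where $g=\frac49(\theta_3-\phi)^2+\frac13\omega^2$ (here squares denote sums of symmetric squares of the $i,j,k$ components). Nearly Kähler structure on $S^3\times S^3$. It is given by $g$ and the forms $$\varpi=\tfrac{2}{3\sqrt3}\mathrm{Re}\big(\omega\wedge(\theta_3-\phi)\big),\qquad \Omega_1=\tfrac{1}{3\sqrt3}\omega^{123}+\tfrac{2}{9\sqrt3}\mathrm{Re}\big(\omega\wedge(\theta_3-\phi)^2\big),$$ $$\Omega_2=-\tfrac{4}{81}(\theta_3-\phi)^3+\tfrac19\mathrm{Re}\big(\omega^2\wedge(\theta_3-\phi)\big),$$ which satisfy $d\varpi=3\Omega_1$, $d\Omega_2=-2\varpi^2$. A connection with curvature $F$ on a bundle over $S^3\times S^3$ is Hermitian Yang--Mills if $F\wedge\varpi^2=0$ and $F\wedge\Omega=0$ where $\Omega=\Omega_1+i\Omega_2$. Asymptotic. A connection $d+A$ on the trivial bundle over $X$ is asymptotic to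 the pull-back of $d+\widetilde A$ if, on the end $(3,\infty)\times(S^3\times S^3)$ with projection $\pi$ to $S^3\times S^3$, $\rho\,|A-\pi^*\widetilde A|_{g_{con}}\to0$ uniformly as $\rho\to\infty$ (equivalently, the $d\rho$-component of $\rho A$ tends to $0$ and the restrictions of $A$ to the slices $\{\rho\}\times(S^3\times S^3)$ converge uniformly to $\widetilde A$ with respect to the fixed metric $g$). *)

(* Defs.v *)
From HB Require Import structures.
From mathcomp Require Import all_boot all_order all_algebra all_fingroup.
From mathcomp Require Import all_classical all_reals all_analysis.

Set Implicit Arguments.
Unset Strict Implicit.
Unset Printing Implicit Defensive.

Import Order.TTheory GRing.Theory Num.Theory.
Import numFieldNormedType.Exports.

Local Open Scope classical_set_scope.
Local Open Scope ring_scope.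

(* A point of X = (S^3 x S^3 x H)/S^3, or of S^3 x S^3 = (S^3)^3/S^3, is
   represented by a triple in the ambient vector space H^3, and a form on the
   quotient by a form on S^3 x S^3 x H (resp. (S^3)^3) that is invariant under
   the right S^3-action and vanishes on vectors tangent to the orbits.  Forms on
   the submanifolds S^3 x S^3 x H and (S^3)^3 of H^3 are given by ambient
   formulas; only their values on tangent vectors at points of the submanifold
   are meaningful, so every condition below is restricted to those. *)

Section Defs.
Context {R : realType}.

(* the coordinates 0, 1, 2, 3 are those along 1, i, j, k *)
Definition quat := 'rV[R]_4.

Definition qre (p : quat) : R := p 0 ord0.
Definition qim (p : quat) (i : 'I_3) : R := p 0 (lift ord0 i).

Definition mkq (a b c d : R) : quat := \row_(i < 4) [:: a; b; c; d]`_i.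

Definition mulq (p q : quat) : quat :=
  let a := qre p in let b := qim p 0 in let c := qim p 1 in let d := qim p 2 in
  let a' := qre q in let b' := qim q 0 in
  let c' := qim q 1 in let d' := qim q 2 in
  mkq (a * a' - b * b' - c * c' - d * d')
      (a * b' + b * a' + c * d' - d * c')
      (a * c' - b * d' + c * a' + d * b')
      (a * d' + b * c' - c * b' + d * a').

Definition conjq (p : quat) : quat :=
  mkq (qre p) (- qim p 0) (- qim p 1) (- qim p 2).

Definition Imq (p : quat) : quat := mkq 0 (qim p 0) (qim p 1) (qim p 2).

Definition imaginary (p : quat) : Prop := qre p = 0.

(* The library norm on row vectors is the sup norm, hence this definition. *)
Definition normq (p : quat) : R := Num.sqrt (\sum_(i < 4) p 0 i ^+ 2).

Definition invq (p : quat) : quat := (normq p ^+ 2)^-1 *: conjq p.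

Definition S3 : set quat := [set g | normq g = 1].

Definition tangentS3 (g u : quat) : Prop := \sum_(i < 4) g 0 i * u 0 i = 0.

Definition quat3 := (quat * quat * quat)%type.

Definition act3 (x : quat3) (q : quat) : quat3 :=
  (mulq x.1.1 q, mulq x.1.2 q, mulq x.2 q).

(* (S^3)^3, whose quotient by the diagonal right action is S^3 x S^3 *)
Definition linkN : set quat3 := [set x | S3 x.1.1 /\ S3 x.1.2 /\ S3 x.2].

Definition tangentN (x u : quat3) : Prop :=
  [/\ tangentS3 x.1.1 u.1.1, tangentS3 x.1.2 u.1.2 & tangentS3 x.2 u.2].

(* S^3 x S^3 x H, whose quotient is X *)
Definition totalY : set quat3 := [set x | S3 x.1.1 /\ S3 x.1.2].

Definition tangentY (x u : quat3) : Prop :=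
  tangentS3 x.1.1 u.1.1 /\ tangentS3 x.1.2 u.1.2.

Definition diff_form (k : nat) (V : Type) := quat3 -> ('I_k -> quat3) -> V.

Definition ev1 (V : Type) (A : diff_form 1 V) (x u : quat3) : V :=
  A x (fun=> u).

(* wedge product with respect to a bilinear product of the values, normalized by
   (A /\ B)(u, v) = A(u) B(v) - A(v) B(u) for 1-forms *)
Definition wedge (p q : nat) (U V : Type) (W : lmodType R) (mul : U -> V -> W)
    (A : diff_form p U) (B : diff_form q V) : diff_form (p + q) W :=
  fun x v => ((p`! * q`!)%N%:R : R)^-1 *:
    \sum_(s : 'S_(p + q)) (-1 : R) ^+ odd_perm s *:
      mul (A x (fun i => v (s (lshift q i))))
          (B x (fun j => v (s (rshift p j)))).

Definition wedgeQ (p q : nat) (A : diff_form p quat) (B : diff_form q quat) :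
  diff_form (p + q) quat := wedge mulq A B.

Definition wedgeR (p q : nat) (A : diff_form p R^o) (B : diff_form q R^o) :
  diff_form (p + q) R^o := wedge (fun a b : R => a * b : R^o) A B.

Definition wedgeQR (p q : nat) (A : diff_form p quat) (B : diff_form q R^o) :
  diff_form (p + q) quat := wedge (fun (a : quat) (b : R) => b *: a) A B.

Definition reF (k : nat) (A : diff_form k quat) : diff_form k R^o :=
  fun x v => qre (A x v).

Definition imF (k : nat) (i : 'I_3) (A : diff_form k quat) :
  diff_form k R^o :=
  fun x v => qim (A x v) i.

(* exterior derivative in the ambient space; it commutes with the restriction to
   submanifolds *)
Definition extd (k : nat) (A : diff_form k quat) : diff_form k.+1 quat :=
  fun x v => \sum_(i < k.+1) (-1 : R) ^+ i *:
    'D_(v i) (fun y => A y (fun j => v (lift i j)) : quat) x.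

Definition theta1 : diff_form 1 quat :=
  fun x v => mulq (invq x.1.1) (v ord0).1.1.
Definition theta2 : diff_form 1 quat :=
  fun x v => mulq (invq x.1.2) (v ord0).1.2.
Definition theta3 : diff_form 1 quat :=
  fun x v => mulq (invq x.2) (v ord0).2.

Definition phi : diff_form 1 quat :=
  fun x v => (2^-1 : R) *: (theta1 x v + theta2 x v).

Definition omega : diff_form 1 quat := fun x v => theta1 x v - theta2 x v.

Definition psi : diff_form 1 quat := fun x v => theta3 x v - phi x v.

(* the metric (4/9) (theta3 - phi)^2 + (1/3) omega^2 *)
Definition gNK (x u v : quat3) : R :=
  4 / 9 * (\sum_(i < 3) qim (ev1 psi x u) i * qim (ev1 psi x v) i)
  + 1 / 3 * (\sum_(i < 3) qim (ev1 omega x u) i * qim (ev1 omega x v) i).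

Definition varpi : diff_form 2 R^o :=
  fun x v => 2 / (3 * Num.sqrt 3) * reF (wedgeQ omega psi) x v.

Definition Omega1 : diff_form 3 R^o := fun x v =>
  1 / (3 * Num.sqrt 3) *
    wedgeR (wedgeR (imF 0 omega) (imF 1 omega)) (imF 2 omega) x v
  + 2 / (9 * Num.sqrt 3) * reF (wedgeQ omega (wedgeQ psi psi)) x v.

(* On tangent vectors psi is imaginary-valued, so its cube is real-valued and
   taking its real part changes nothing. *)
Definition Omega2 : diff_form 3 R^o := fun x v =>
  - (4 / 81) * reF (wedgeQ (wedgeQ psi psi) psi) x v
  + 1 / 9 * reF (wedgeQ (wedgeQ omega omega) psi) x v.

(* C^infinity: all iterated directional derivatives are differentiable *)
Definition iterD (f : quat3 -> quat) (us : seq quat3) : quat3 -> quat :=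
  foldr (fun u h => fun x => 'D_u h x) f us.

Definition smooth (f : quat3 -> quat) : Prop :=
  forall (us : seq quat3) (x : quat3), differentiable (iterD f us) x.

(* A : an SU(2)-connection d + A on the trivial C^2-bundle over
   S^3 x S^3 = (S^3)^3/S^3, with su(2) = Im H.  As (S^3)^3 is a closed
   submanifold, its smooth 1-forms are the restrictions of ambient ones. *)
Definition su2_connection (A : diff_form 1 quat) : Prop :=
  [/\ forall u, smooth (fun x => ev1 A x u),
      forall x (c : R) u v, ev1 A x (c *: u + v) = c *: ev1 A x u + ev1 A x v,
      forall x u, linkN x -> tangentN x u -> imaginary (ev1 A x u),
      forall x xi, linkN x -> imaginary xi -> ev1 A x (act3 x xi) = 0 &
      forall x u q, linkN x -> tangentN x u -> S3 q ->
        ev1 A (act3 x q) (act3 u q) = ev1 A x u].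

Definition curvature (A : diff_form 1 quat) : diff_form 2 quat :=
  fun x v => extd A x v + wedgeQ A A x v.

Definition vanishesN (k : nat) (B : diff_form k quat) : Prop :=
  forall x v, linkN x -> (forall i, tangentN x (v i)) -> B x v = 0.

Definition flat_connection (A : diff_form 1 quat) : Prop :=
  vanishesN (curvature A).

(* F /\ Omega = F /\ Omega1 + i F /\ Omega2 takes values in the
   complexification of Im H, where F, Omega1 and Omega2 are real. *)
Definition hermitian_yang_mills (A : diff_form 1 quat) : Prop :=
  [/\ vanishesN (wedgeQR (curvature A) (wedgeR varpi varpi)),
      vanishesN (wedgeQR (curvature A) Omega1) &
      vanishesN (wedgeQR (curvature A) Omega2)].

(* On S^3 x S^3 x H the projection a to H is the third component.
   The form A_C = f_C A_1 lives there; it is basic, hence a form on X. *)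
Definition alpha : diff_form 1 quat :=
  fun x v => (v ord0).2 - mulq x.2 (phi x v).

Definition A_1 : diff_form 1 quat :=
  fun x v => Imq (mulq x.2 (conjq (alpha x v))).

Definition f_C (C : R) (x : quat3) : R :=
  let s := 1 + normq x.2 ^+ 2 in 2 / (3 * s + C * s `^ (1 / 3)).

Definition instanton (C : R) : diff_form 1 quat :=
  fun x v => f_C C x *: A_1 x v.

Definition rho (x : quat3) : R^o := 3 * (1 + normq x.2 ^+ 2) `^ (1 / 3).

(* the projection of the end to S^3 x S^3, via a = |a| g_3 *)
Definition proj (x : quat3) : quat3 := (x.1, (normq x.2)^-1 *: x.2).

Definition pullback_proj (A : diff_form 1 quat) : diff_form 1 quat :=
  fun x v => A (proj x) (fun i => 'D_(v i) proj x).

(* the cone metric d rho^2 + rho^2 g on X \ {a = 0} *)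
Definition gcon (x u v : quat3) : R :=
  'D_u rho x * 'D_v rho x
  + rho x ^+ 2 * gNK (proj x) ('D_u proj x) ('D_v proj x).

(* Lifts to S^3 x S^3 x H of orthonormal frames of the 7-manifold X at x: gcon
   is degenerate exactly along the orbits. *)
Definition orthonormal_frame (x : quat3) (e : 'I_7 -> quat3) : Prop :=
  (forall i, tangentY x (e i)) /\
  (forall i j, gcon x (e i) (e j) = (i == j)%:R).

(* pointwise norm; for a 1-form on X the sum does not depend on the frame, and
   the supremum serves only to select its value *)
Definition norm_gcon (B : diff_form 1 quat) (x : quat3) : R :=
  sup [set r : R | exists2 e, orthonormal_frame x e &
    r = Num.sqrt (\sum_(i < 7) normq (ev1 B x (e i)) ^+ 2)].

Definition asymptotic_to_pullback (A At : diff_form 1 quat) : Prop :=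
  forall eps : R, 0 < eps -> exists M : R,
    forall x, totalY x -> x.2 != 0 -> M < rho x ->
      rho x * norm_gcon (fun y v => A y v - pullback_proj At y v) x < eps.

End Defs.

(* Main.v *)
(** Writing [a = |a| g3], one has [A_1 = - |a|^2 g3 psi g3^-1] with
    [psi = theta3 - phi], and [f_C |a|^2] tends to [2/3], so the limit can only be
    [At = - (2/3) g3 psi g3^-1].  The gauge transformation [g3] takes it to
    [phi + psi / 3], whose curvature is, by the Maurer-Cartan equations,
    [- omega^2 / 6 - (2/9) psi^2].  In terms of the six real 1-forms [omega^i],
    [psi^i], each component of [F /\ varpi^2] only has terms with a repeated factor,
    and in [F /\ Omega1] and [F /\ Omega2] the two terms that survive cancel.
    For the convergence, [A_C - pi^* At] is [2/3 - f_C |a|^2] times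
    [g3 psi g3^-1]; on [gcon]-unit vectors [rho |psi| <= 3/2], and the
    coefficient is O(1 / rho). *)

Require Import Defs.
From HB Require Import structures.
From mathcomp Require Import all_boot all_order all_algebra all_fingroup.
From mathcomp Require Import all_classical all_reals all_analysis.
From mathcomp Require Import ring lra.
(* Imported again because [rat] also exports a [mulq] and an [invq]. *)
Require Import Defs.

Set Implicit Arguments.
Unset Strict Implicit.
Unset Printing Implicit Defensive.

Import Order.TTheory GRing.Theory Num.Theory.
Import numFieldNormedType.Exports.
Local Open Scope ring_scope.

(** * Wedge products of monomials in 1-forms *)

Section BlockPerm.
Variables p q : nat.
Implicit Types (t : 'S_p) (u : 'S_q).

Definition block_fun t u (i : 'I_(p + q)) : 'I_(p + q) :=
  match fintype.split i with
  | inl a => lshift q (t a)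
  | inr b => rshift p (u b)
  end.

Lemma block_fun_inj t u : injective (block_fun t u).
Proof.
rewrite /block_fun => i j.
case: (split_ordP i) => a ->; case: (split_ordP j) => b ->;
  rewrite ?(unsplitK (inl _)) ?(unsplitK (inr _)) => /eqP;
  rewrite ?eq_lshift ?eq_rshift ?eq_lrshift ?eq_rlshift // => /eqP /perm_inj -> //.
Qed.

Definition block_perm t u : 'S_(p + q) := perm (@block_fun_inj t u).

Lemma block_perml t u a : block_perm t u (lshift q a) = lshift q (t a).
Proof. by rewrite permE /block_fun (unsplitK (inl a)). Qed.

Lemma block_permr t u b : block_perm t u (rshift p b) = rshift p (u b).
Proof. by rewrite permE /block_fun (unsplitK (inr b)). Qed.

(** The sign of a permutation is the determinant of its matrix, and the matrix of [block_perm t u]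
    is block diagonal. *)
Lemma sign_block_perm (R : comNzRingType) t u :
  (-1) ^+ block_perm t u = (-1) ^+ t * (-1) ^+ u :> R.
Proof.
rewrite -!det_perm -(det_ublock _ 0); congr (\det _).
apply/matrixP => i j; rewrite !mxE.
case: (split_ordP i) => a ->; rewrite !mxE ?block_perml ?block_permr;
  case: (split_ordP j) => b ->; rewrite !mxE ?eq_lshift ?eq_rshift ?eq_lrshift ?eq_rlshift //.
Qed.

(* Laplace expansion along the first [p] rows, antisymmetrized over all
   permutations instead of over shuffles. *)
Lemma det_antisym_blocks (R : comNzRingType) (M : 'M[R]_(p + q)) :
  \sum_(s : 'S_(p + q)) (-1) ^+ s *
     (\det (\matrix_(i < p, j < p) M (lshift q i) (s (lshift q j))) *
      \det (\matrix_(i < q, j < q) M (rshift p i) (s (rshift p j))))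
  = (p`! * q`!)%:R * \det M.
Proof.
(* Expanding both minors over [t] and [u] gives one product over all rows, taken along the composite
   of [block_perm t u] and [s]. *)
transitivity (\sum_(s : 'S_(p + q)) \sum_(t : 'S_p) \sum_(u : 'S_q)
   (-1) ^+ (block_perm t u * s)%g * \prod_i M i ((block_perm t u * s)%g i)).
  apply: eq_bigr => s _.
  rewrite /determinant big_distrl /= big_distrr /=; apply: eq_bigr => t _.
  rewrite big_distrr /= big_distrr /=; apply: eq_bigr => u _.
  rewrite odd_permM signr_addb sign_block_perm big_split_ord /=.
  under [X in _ = _ * (X * _)]eq_bigr do rewrite permM block_perml.
  under [X in _ = _ * (_ * X)]eq_bigr do rewrite permM block_permr.
  under [X in _ * (_ * X * _)]eq_bigr do rewrite mxE.
  under [X in _ * (_ * (_ * X))]eq_bigr do rewrite mxE.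
  by rewrite mulrACA [in RHS](mulrC (_ * _) (_ ^+ s)) !mulrA.
rewrite exchange_big; under eq_bigr do rewrite exchange_big.
(* For fixed [t] and [u], left translation by [block_perm t u] permutes the [s], so the inner sum is
   [\det M]. *)
transitivity (\sum_(t : 'S_p) \sum_(u : 'S_q) \det M).
  apply: eq_bigr => t _; apply: eq_bigr => u _.
  by rewrite /determinant [RHS](reindex_inj (mulgI (block_perm t u))).
by rewrite !sumr_const !card_Sn natrM -[in RHS]mulrA !mulr_natl -mulrnA mulnC mulrnA.
Qed.

End BlockPerm.

Lemma linear0_of (R : pzRingType) (U V : lmodType R) (f : U -> V) :
  (forall c u w, f (c *: u + w) = c *: f u + f w) -> f 0 = 0.
Proof. by move=> /(_ (-1) 0 0); rewrite !scaleN1r !addNr. Qed.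

(** * Alternating monomials and their sorting *)

Section Monomials.
Context {R : realType}.
Variable e : nat -> quat3 (R := R) -> R.
Variable P : quat3 (R := R) -> Prop.

(** The value on [v] of the wedge product of the covectors [e i] for [i] in [l], which is a
    determinant in the normalization of [wedge]. The indices form a list of numbers so that sorting
    reduces by computation; the default of [nth] is never reached when [size l = k]. *)
Definition mono k (l : seq nat) (v : 'I_k -> quat3 (R := R)) : R :=
  \det (\matrix_(i < k, j < k) e (nth 0%N l i) (v j)).

(** The two matrices differ by an exchange of adjacent rows. The prefix [a] allows the exchange in
    the middle of a list, as the sorting inductions require. *)
Lemma mono_swap k a b x y (v : 'I_k -> quat3) :
  (size a + size b).+2 = k ->
  mono (a ++ x :: y :: b) v = - mono (a ++ y :: x :: b) v.
Proof.
move=> sk.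
have i1P : (size a < k)%N by rewrite -sk ltnS ltnW// ltnS leq_addr.
have i2P : ((size a).+1 < k)%N by rewrite -sk !ltnS leq_addr.
pose i1 := Ordinal i1P; pose i2 := Ordinal i2P.
have ne : i1 != i2 by rewrite -val_eqE /= neq_ltn ltnSn.
rewrite /mono; set M := matrix_of_fun _ _.
have -> : M = xrow i1 i2 (\matrix_(i < k, j < k)
    e (nth 0%N (a ++ y :: x :: b) i) (v j)).
  apply/matrixP => i j; rewrite !mxE; congr (e _ _).
  case: tpermP => [->|->|/eqP n1 /eqP n2] /=.
  - by rewrite !nth_cat ltnn subnn ltnNge leqnSn /= subSnn.
  - by rewrite !nth_cat ltnn subnn ltnNge leqnSn /= subSnn.
  - rewrite !nth_cat; case: ltnP => // le.
    move: n1 n2; rewrite -!val_eqE /= => n1 n2.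
    case: (i - size a)%N (subnKC le) => [|[|m]] //= h; move: n1 n2.
    + by rewrite -h addn0 eqxx.
    + by rewrite -h addn1 eqxx.
by rewrite xrowE det_mulmx det_perm odd_tperm ne mulN1r.
Qed.

Lemma mono_nuniq k l (v : 'I_k -> quat3) : size l = k -> ~~ uniq l ->
  mono l v = 0.
Proof.
move=> sl /(uniqPn 0%N)[i [j [ij]]]; rewrite sl => jk nij.
apply: (determinant_alternate (i1 := Ordinal (ltn_trans ij jk)) (i2 := Ordinal jk)).
  by rewrite -val_eqE /= ltn_eqF.
by move=> m; rewrite !mxE /= nij.
Qed.

(** The boolean is the parity of the number of entries that [x] passes. *)
Fixpoint insert_sign (x : nat) (l : seq nat) : bool * seq nat :=
  if l is y :: l' then
    if (x <= y)%N then (false, x :: l)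
    else let: (b, m) := insert_sign x l' in (~~ b, y :: m)
  else (false, [:: x]).

(* Insertion sort, together with the parity of the number of transpositions *)
Fixpoint sort_sign (l : seq nat) : bool * seq nat :=
  if l is x :: l' then
    let: (b, m) := sort_sign l' in
    let: (c, m') := insert_sign x m in (b (+) c, m')
  else (false, [::]).

Lemma size_insert_sign x l : size (insert_sign x l).2 = (size l).+1.
Proof.
elim: l => //= y l; case: (insert_sign x l) => b m /= IH.
by case: ifP => //= _; rewrite IH.
Qed.

Lemma size_sort_sign l : size (sort_sign l).2 = size l.
Proof.
elim: l => //= y l; case: (sort_sign l) => b m /= IH.
by case: (insert_sign y m) (size_insert_sign y m) => c m' /= ->; rewrite IH.
Qed.

Lemma mono_insert k a x l (v : 'I_k -> quat3) : (size a + size l).+1 = k ->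
  mono (a ++ x :: l) v =
    (-1) ^+ (insert_sign x l).1 * mono (a ++ (insert_sign x l).2) v.
Proof.
elim: l a => [|y l IH] a /= sk; first by rewrite mul1r.
case: ifP => _; first by rewrite mul1r.
rewrite addnS in sk; rewrite mono_swap// -cat_rcons IH ?size_rcons ?addSn//.
by case: (insert_sign x l) => b m /=; rewrite cat_rcons signrN mulNr.
Qed.

Lemma mono_sort k a l (v : 'I_k -> quat3) : (size a + size l)%N = k ->
  mono (a ++ l) v = (-1) ^+ (sort_sign l).1 * mono (a ++ (sort_sign l).2) v.
Proof.
elim: l a => [|x l IH] a /= sk; first by rewrite mul1r.
rewrite -cat_rcons IH ?size_rcons ?addSnnS//.
have := size_sort_sign l; case: (sort_sign l) => b m /= sm; rewrite cat_rcons.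
rewrite mono_insert ?sm -?addnS//; case: (insert_sign x m) => c m' /=.
by rewrite mulrA signr_addb.
Qed.

(** * Forms as lists of monomials with coefficients *)

Section Rep.
Variable U : lmodType R.

Definition msum k (g : seq (seq nat * U)) (v : 'I_k -> quat3) : U :=
  \sum_(t <- g) mono t.1 v *: t.2.

(** Like monomials stay separate here; [ring] or [lra] collects them once the sum is unfolded. *)
Definition normal_form (g : seq (seq nat * U)) : seq (seq nat * U) :=
  [seq ((sort_sign t.1).2, (-1) ^+ (sort_sign t.1).1 *: t.2) | t <- g & uniq t.1].

Lemma msum_normal_form k g (v : 'I_k -> quat3) :
  all (fun t => size t.1 == k) g -> msum (normal_form g) v = msum g v.
Proof.
rewrite /msum /normal_form; elim: g => //= t g IH /andP[/eqP st sg].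
rewrite [RHS]big_cons; case: ifP => [_|/negbT nu]; last first.
  by rewrite IH// mono_nuniq// scale0r add0r.
rewrite map_cons big_cons IH //= -(cat0s t.1) (@mono_sort k [::])//=.
by rewrite scalerA mulrC.
Qed.

(* [U]-valued [k]-forms at a point, on vectors satisfying [P], written in the
   exterior algebra of the covectors [e] *)
Definition rep x k (A : diff_form (R := R) k U) g :=
  all (fun t : seq nat * U => size t.1 == k) g /\
  forall v, (forall i, P (v i)) -> A x v = msum g v.

(** Allows passing to a list [h] simplified by hand: for concrete lists the first premise unfolds to
    an identity linear in the values of sorted monomials. *)
Lemma rep_normal x k (A : diff_form k U) g h :
  (forall v : 'I_k -> quat3, msum (normal_form g) v = msum h v) ->
  all (fun t => size t.1 == k) h -> rep x A g -> rep x A h.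
Proof.
by move=> E sh [sg Ag]; split=> // v Pv; rewrite Ag// -msum_normal_form.
Qed.

End Rep.

Lemma rep_map (U V : lmodType R) (f : U -> V) x k (A : diff_form k U) g :
  (forall c u w, f (c *: u + w) = c *: f u + f w) -> rep x A g ->
  rep x (fun y v => f (A y v)) [seq (t.1, f t.2) | t <- g].
Proof.
move=> lf [sg Ag].
have f0 := linear0_of lf.
split; first by rewrite all_map; apply: sub_all sg => t.
move=> v Pv; rewrite Ag// /msum big_map /=.
elim: g {sg Ag} => [|t g IH]; first by rewrite !big_nil.
by rewrite !big_cons lf IH.
Qed.

Lemma rep_add (U : lmodType R) x k (A B : diff_form k U) g h :
  rep x A g -> rep x B h -> rep x (fun y v => A y v + B y v) (g ++ h).
Proof.
move=> [sg Ag] [sh Bh]; split; first by rewrite all_cat sg.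
by move=> v Pv; rewrite Ag// Bh// /msum big_cat.
Qed.

(** Bilinearity reduces the claim to a pair of monomials. For these, [det_antisym_blocks] evaluates
    the antisymmetrized product of minors as [p! q!] times the determinant of the concatenated list,
    and the factorials cancel against the normalization of [wedge]. *)
Lemma rep_wedge (U V W : lmodType R) (mul : U -> V -> W) x p q
    (A : diff_form p U) (B : diff_form q V) g h :
  (forall a c u w, mul a (c *: u + w) = c *: mul a u + mul a w) ->
  (forall b c u w, mul (c *: u + w) b = c *: mul u b + mul w b) ->
  rep x A g -> rep x B h ->
  rep x (wedge mul A B)
    [seq (a.1 ++ b.1, mul a.2 b.2) | a <- g, b <- h].
Proof.
move=> mr ml [sg Ag] [sh Bh]; split.
  apply/allP => t /allpairsP[[a b] /= [/(allP sg)/eqP + /(allP sh)/eqP + ->]] /=.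
  by rewrite size_cat => -> ->.
move=> v Pv; rewrite /msum big_allpairs_dep /wedge /=.
have m0r a : mul a 0 = 0 := linear0_of (mr a).
have m0l b : mul 0 b = 0 := linear0_of (f := mul^~ b) (ml b).
have msl s (f : _ -> R) (u : _ -> U) b : mul (\sum_(t <- s : seq (seq nat * U)) f t *: u t) b =
    \sum_(t <- s) f t *: mul (u t) b.
  by elim: s => [|t s IH]; rewrite ?big_nil// !big_cons ml IH.
have msr s (f : _ -> R) (u : _ -> V) a : mul a (\sum_(t <- s : seq (seq nat * V)) f t *: u t) =
    \sum_(t <- s) f t *: mul a (u t).
  by elim: s => [|t s IH]; rewrite ?big_nil// !big_cons mr IH.
under [X in _ *: X]eq_bigr => s _.
  rewrite Ag// Bh// /msum msl.
  under eq_bigr do rewrite msr scaler_sumr.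
  rewrite scaler_sumr; over.
rewrite exchange_big /= scaler_sumr big_seq [RHS]big_seq.
apply: eq_bigr => a /(allP sg)/eqP sa.
under eq_bigr => s _ do rewrite scaler_sumr.
rewrite exchange_big /= scaler_sumr big_seq [RHS]big_seq.
apply: eq_bigr => b /(allP sh)/eqP sb.
under eq_bigr => s _ do rewrite !scalerA.
rewrite -scaler_suml scalerA; congr (_ *: _).
have nz : (p`! * q`!)%N%:R != 0 :> R by rewrite pnatr_eq0 -lt0n muln_gt0 !fact_gt0.
apply: (canLR (mulKf nz)).
rewrite -det_antisym_blocks; apply: eq_bigr => s _; rewrite -mulrA; congr (_ * (_ * _)).
  by congr (\det _); apply/matrixP => i j; rewrite !mxE nth_cat /= sa ltn_ord.
congr (\det _); apply/matrixP => i j; rewrite !mxE nth_cat /= sa.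
by rewrite ltnNge leq_addr addKn.
Qed.

End Monomials.

(** * Quaternion algebra *)

Section QuaternionCoordinates.
Context {R : realType}.
Local Notation quat := (quat (R := R)).
Implicit Types (p q r : quat) (a b c d : R).

Lemma qre_mkq a b c d : qre (mkq a b c d) = a.
Proof. by rewrite /qre mxE. Qed.

Lemma qim0_mkq a b c d : qim (mkq a b c d) 0 = b.
Proof. by rewrite /qim mxE. Qed.

Lemma qim1_mkq a b c d : qim (mkq a b c d) 1 = c.
Proof. by rewrite /qim mxE. Qed.

Lemma qim2_mkq a b c d : qim (mkq a b c d) 2 = d.
Proof. by rewrite /qim mxE. Qed.

Definition qcoord := (qre_mkq, qim0_mkq, qim1_mkq, qim2_mkq).

Lemma ord4P (P : 'I_4 -> Prop) :
  P ord0 -> P (lift ord0 0) -> P (lift ord0 1) -> P (lift ord0 2) ->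
  forall i, P i.
Proof.
move=> P0 P1 P2 P3 [[|[|[|[|//]]]] lti];
  [move: P0|move: P1|move: P2|move: P3]; by congr P; apply: val_inj.
Qed.

Lemma quatE p : p = mkq (qre p) (qim p 0) (qim p 1) (qim p 2).
Proof. by apply/rowP; apply: ord4P; rewrite mxE. Qed.

Lemma quat_mk p : exists a b c d, p = mkq a b c d.
Proof. by rewrite (quatE p); do 4!eexists. Qed.

Lemma addq_mkq a b c d a' b' c' d' :
  mkq a b c d + mkq a' b' c' d' = mkq (a + a') (b + b') (c + c') (d + d').
Proof. by apply/rowP; apply: ord4P; rewrite !mxE. Qed.

Lemma scaleq_mkq k a b c d :
  k *: mkq a b c d = mkq (k * a) (k * b) (k * c) (k * d).
Proof. by apply/rowP; apply: ord4P; rewrite !mxE. Qed.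

Lemma oppq_mkq a b c d : - mkq a b c d = mkq (- a) (- b) (- c) (- d).
Proof. by apply/rowP; apply: ord4P; rewrite !mxE. Qed.

Lemma zeroq_mkq : 0 = mkq 0 0 0 0 :> quat.
Proof. by apply/rowP; apply: ord4P; rewrite !mxE. Qed.

Lemma mulq_mkq a b c d a' b' c' d' :
  mulq (mkq a b c d) (mkq a' b' c' d') =
  mkq (a * a' - b * b' - c * c' - d * d') (a * b' + b * a' + c * d' - d * c')
      (a * c' - b * d' + c * a' + d * b') (a * d' + b * c' - c * b' + d * a').
Proof. by rewrite /mulq !qcoord. Qed.

Lemma conjq_mkq a b c d : conjq (mkq a b c d) = mkq a (- b) (- c) (- d).
Proof. by rewrite /conjq !qcoord. Qed.

Lemma Imq_mkq a b c d : Imq (mkq a b c d) = mkq 0 b c d.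
Proof. by rewrite /Imq !qcoord. Qed.

Lemma sum_coord (F : 'I_4 -> R) :
  \sum_i F i = F ord0 + F (lift ord0 0) + F (lift ord0 1) + F (lift ord0 2).
Proof.
rewrite !big_ord_recl big_ord0 addr0 !addrA.
by congr (_ + F _ + F _ + F _); apply: val_inj.
Qed.

Definition dotq p q : R := \sum_(i < 4) p 0 i * q 0 i.

Lemma dotq_mkq a b c d a' b' c' d' :
  dotq (mkq a b c d) (mkq a' b' c' d') = a * a' + b * b' + c * c' + d * d'.
Proof. by rewrite /dotq sum_coord !mxE. Qed.

Lemma sqr_normq p : normq p ^+ 2 = dotq p p.
Proof.
rewrite sqr_sqrtr; first by apply: eq_bigr => i _; rewrite expr2.
by apply: sumr_ge0 => i _; rewrite sqr_ge0.
Qed.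

Definition qmk := (addq_mkq, scaleq_mkq, oppq_mkq, zeroq_mkq, mulq_mkq,
  conjq_mkq, Imq_mkq, qcoord, dotq_mkq).

End QuaternionCoordinates.

(** Coordinates turn a quaternion identity into four real polynomial identities, and a real-valued
    one into a single identity; [lra] closes them by its ring normalization. *)
Ltac quat_ring :=
  repeat match goal with |- forall p : _, _ =>
    let p := fresh "p" in
    intro p; case: (quat_mk p) => ? [? [? [? ->]]]; clear p
  end;
  rewrite ?qmk; first [congr mkq; lra | lra].

Section QuaternionAlgebra.
Context {R : realType}.
Local Notation quat := (quat (R := R)).
Implicit Types (p q r : quat).

Definition quat1 : quat := mkq 1 0 0 0.

Lemma mulqA p q r : mulq p (mulq q r) = mulq (mulq p q) r.
Proof. move: p q r; quat_ring. Qed.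

Lemma mulqDl p q r : mulq (p + q) r = mulq p r + mulq q r.
Proof. move: p q r; quat_ring. Qed.

Lemma mulqDr p q r : mulq p (q + r) = mulq p q + mulq p r.
Proof. move: p q r; quat_ring. Qed.

Lemma mulqNl p q : mulq (- p) q = - mulq p q.
Proof. move: p q; quat_ring. Qed.

Lemma mulqNr p q : mulq p (- q) = - mulq p q.
Proof. move: p q; quat_ring. Qed.

Lemma mulqZl k p q : mulq (k *: p) q = k *: mulq p q.
Proof. move: p q; quat_ring. Qed.

Lemma mulqZr k p q : mulq p (k *: q) = k *: mulq p q.
Proof. move: p q; quat_ring. Qed.

Lemma mulq0 p : mulq p 0 = 0.
Proof. move: p; quat_ring. Qed.

Lemma mul0q p : mulq 0 p = 0.
Proof. move: p; quat_ring. Qed.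

Lemma mulq1 p : mulq p quat1 = p.
Proof. rewrite /quat1; move: p; quat_ring. Qed.

Lemma mul1q p : mulq quat1 p = p.
Proof. rewrite /quat1; move: p; quat_ring. Qed.

Lemma mulq_linear p k q r : mulq p (k *: q + r) = k *: mulq p q + mulq p r.
Proof. by rewrite mulqDr mulqZr. Qed.

Lemma mulq_linearl p k q r : mulq (k *: q + r) p = k *: mulq q p + mulq r p.
Proof. by rewrite mulqDl mulqZl. Qed.

Lemma conjqM p q : conjq (mulq p q) = mulq (conjq q) (conjq p).
Proof. move: p q; quat_ring. Qed.

Lemma conjZq k p : conjq (k *: p) = k *: conjq p.
Proof. move: p; quat_ring. Qed.

Definition qi : quat := mkq 0 1 0 0.
Definition qj : quat := mkq 0 0 1 0.
Definition qk : quat := mkq 0 0 0 1.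

(* Makes conjugation a polynomial in the ring operations, so that its derivative
   follows from the product rule. *)
Lemma conjq_mulq p : conjq p = - 2^-1 *:
  (p + mulq (mulq qi p) qi + mulq (mulq qj p) qj + mulq (mulq qk p) qk).
Proof.
rewrite /qi /qj /qk; move: p; quat_ring.
Qed.

Lemma mulq_conj p : mulq p (conjq p) = dotq p p *: quat1.
Proof. rewrite /quat1; move: p; quat_ring. Qed.

Lemma mul_conjq p : mulq (conjq p) p = dotq p p *: quat1.
Proof. rewrite /quat1; move: p; quat_ring. Qed.

Lemma qre_conjM p q : qre (mulq (conjq p) q) = dotq p q.
Proof. move: p q; quat_ring. Qed.

Lemma dotqZl k p q : dotq (k *: p) q = k * dotq p q.
Proof. move: p q; quat_ring. Qed.

Lemma dotqZr k p q : dotq p (k *: q) = k * dotq p q.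
Proof. move: p q; quat_ring. Qed.

Lemma dotqM p q : dotq (mulq p q) (mulq p q) = dotq p p * dotq q q.
Proof. move: p q; quat_ring. Qed.

Lemma dotq_conj p : dotq (conjq p) (conjq p) = dotq p p.
Proof. move: p; quat_ring. Qed.

Lemma normq_ge0 p : 0 <= normq p.
Proof. exact: sqrtr_ge0. Qed.

Lemma normqM p q : normq (mulq p q) = normq p * normq q.
Proof.
apply/eqP; rewrite -(@eqrXn2 _ 2) ?mulr_ge0 ?normq_ge0//.
by rewrite exprMn !sqr_normq dotqM.
Qed.

Lemma normq_conj p : normq (conjq p) = normq p.
Proof. by apply/eqP; rewrite -(@eqrXn2 _ 2) ?normq_ge0// !sqr_normq dotq_conj. Qed.

Lemma normqZ k p : normq (k *: p) = `|k| * normq p.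
Proof.
apply/eqP; rewrite -(@eqrXn2 _ 2) ?mulr_ge0 ?normq_ge0//.
by rewrite exprMn !sqr_normq dotqZl dotqZr mulrA real_normK ?num_real// expr2.
Qed.

Lemma normq_eq0 p : (normq p == 0) = (p == 0).
Proof.
rewrite -[LHS]sqrf_eq0 sqr_normq; apply/eqP/eqP => [|->]; last first.
  by rewrite zeroq_mkq dotq_mkq !mulr0 !addr0.
move=> /eqP; rewrite psumr_eq0; last by move=> i _; rewrite -expr2 sqr_ge0.
move=> /allP p0; apply/rowP => i; rewrite mxE; apply/eqP.
by have := p0 i (mem_index_enum _); rewrite mulf_eq0 orbb.
Qed.

Lemma S3_dotq p : S3 p -> dotq p p = 1.
Proof. by rewrite /S3 /= -sqr_normq => ->; rewrite expr1n. Qed.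

Lemma S3_mulq_conj p : S3 p -> mulq p (conjq p) = quat1.
Proof. by move=> /S3_dotq p1; rewrite mulq_conj p1 scale1r. Qed.

Lemma S3_mul_conjq p : S3 p -> mulq (conjq p) p = quat1.
Proof. by move=> /S3_dotq p1; rewrite mul_conjq p1 scale1r. Qed.

Lemma S3_invq p : S3 p -> invq p = conjq p.
Proof. by rewrite /S3 /= /invq => ->; rewrite expr1n invr1 scale1r. Qed.

Lemma imaginary_conj p : imaginary p -> conjq p = - p.
Proof.
by rewrite /imaginary (quatE p) qre_mkq => ->; rewrite conjq_mkq oppq_mkq oppr0.
Qed.

Lemma tangentS3_imaginary (g u : quat) : tangentS3 g u -> imaginary (mulq (conjq g) u).
Proof. by rewrite /imaginary qre_conjM. Qed.

Lemma imaginary_conjugate p q : imaginary q -> imaginary (mulq (mulq p q) (conjq p)).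
Proof.
case: (quat_mk p) => ? [? [? [? ->]]]; case: (quat_mk q) => ? [? [? [? ->]]].
by rewrite /imaginary !qmk => ->; ring.
Qed.

End QuaternionAlgebra.

(** * Derivatives of quaternion polynomials *)

Section Calculus.
Context {R : realType}.
Local Notation quat := (quat (R := R)).
Local Notation quat3 := (quat3 (R := R)).
Implicit Types (f g : quat3 -> quat) (x u v : quat3).

Lemma differentiable_quat_coord f x i :
  differentiable f x -> differentiable (fun y => f y 0 i : R) x.
Proof.
move=> df.
exact: (@differentiable_comp _ _ _ _ f (fun p : quat => p 0 i : R) x df
         (differentiable_coord _ _ _)).
Qed.

Lemma derive_quat f x v i : differentiable f x ->
  ('D_v f x) 0 i = 'D_v (fun y => f y 0 i : R) x.
Proof. by move=> df; rewrite derive_mx ?mxE//; apply: diff_derivable. Qed.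

(** Expansion over the basis, which reduces the product rule for quaternions to that for products of
    real functions. *)
Lemma mulq_sum (p q : quat) : mulq p q =
  \sum_i \sum_j (p 0 i * q 0 j) *: mulq (delta_mx 0 i) (delta_mx 0 j).
Proof.
rewrite {1}(row_sum_delta p) {1}(row_sum_delta q).
have -> (r : quat) (h : 'I_4 -> quat) : mulq (\sum_i h i) r = \sum_i mulq (h i) r.
  by rewrite (big_morph (mulq^~ r) (fun a b => mulqDl a b r) (mul0q r)).
apply: eq_bigr => i _.
have -> (r : quat) (h : 'I_4 -> quat) : mulq r (\sum_i h i) = \sum_i mulq r (h i).
  by rewrite (big_morph (mulq r) (mulqDr r) (mulq0 r)).
by apply: eq_bigr => j _; rewrite mulqZl mulqZr scalerA.
Qed.

Lemma differentiable_coordM f g x i j : differentiable f x -> differentiable g x ->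
  differentiable (fun y => f y 0 i * g y 0 j : R) x.
Proof.
move=> df dg.
exact: (differentiableM (differentiable_quat_coord i df) (differentiable_quat_coord j dg)).
Qed.

Lemma mulq_funE f g : (fun y => mulq (f y) (g y)) =
  \sum_i \sum_j (fun y => (f y 0 i * g y 0 j : R) *: (mulq (delta_mx 0 i) (delta_mx 0 j) : quat)).
Proof.
apply/funext => y; rewrite mulq_sum fct_sumE; apply: eq_bigr => i _.
by rewrite fct_sumE.
Qed.

Lemma differentiable_mulq f g x : differentiable f x -> differentiable g x ->
  differentiable (fun y => mulq (f y) (g y)) x.
Proof.
move=> df dg; rewrite mulq_funE.
apply: differentiable_sum => i; apply: differentiable_sum => j.
by apply: differentiableZl; exact: differentiable_coordM.
Qed.

Lemma derive_mulq f g x v : differentiable f x -> differentiable g x ->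
  'D_v (fun y => mulq (f y) (g y)) x =
  mulq ('D_v f x) (g x) + mulq (f x) ('D_v g x).
Proof.
move=> df dg; rewrite mulq_funE.
have dfg i j : differentiable (fun y => (f y 0 i * g y 0 j : R) *:
    (mulq (delta_mx 0 i) (delta_mx 0 j) : quat)) x.
  by apply: differentiableZl; exact: differentiable_coordM.
rewrite derive_sum; last first.
  by move=> i; apply: diff_derivable; apply: differentiable_sum => j.
rewrite !mulq_sum -big_split /=; apply: eq_bigr => i _.
rewrite derive_sum; last by move=> j; apply: diff_derivable.
rewrite -big_split /=; apply: eq_bigr => j _.
rewrite -scalerDl deriveE// diffZl; last exact: differentiable_coordM.
rewrite -deriveE; last exact: differentiable_coordM.
congr (_ *: _); rewrite !derive_quat//.
have dF := diff_derivable (v := v) (differentiable_quat_coord i df).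
have dG := diff_derivable (v := v) (differentiable_quat_coord j dg).
by rewrite (deriveM dF dG) addrC /= mulrC; congr (_ + _); rewrite mulrC.
Qed.

Lemma conjq_funE f : (fun y => conjq (f y)) = - 2^-1 *:
  (f + (fun y => mulq (mulq qi (f y)) qi) + (fun y => mulq (mulq qj (f y)) qj)
     + (fun y => mulq (mulq qk (f y)) qk)).
Proof. by apply/funext => y; rewrite [LHS]conjq_mulq. Qed.

Lemma differentiable_sandwich (p q : quat) f x : differentiable f x ->
  differentiable (fun y => mulq (mulq p (f y)) q) x.
Proof. by move=> df; do ![apply: differentiable_mulq => //]. Qed.

Lemma differentiable_conjq f x : differentiable f x ->
  differentiable (fun y => conjq (f y)) x.
Proof.
move=> df; rewrite conjq_funE; apply: differentiableZ.
have S p q := differentiable_sandwich p q df.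
exact: differentiableD (differentiableD (differentiableD df (S _ _)) (S _ _)) (S _ _).
Qed.

Lemma derive_sandwich (p q : quat) f x v : differentiable f x ->
  'D_v (fun y => mulq (mulq p (f y)) q) x = mulq (mulq p ('D_v f x)) q.
Proof.
move=> df.
have cp r : differentiable (fun=> r : quat) x by exact: differentiable_cst.
have dr r : 'D_v (fun=> r : quat) x = 0 by exact: derive_cst.
rewrite (derive_mulq _ (differentiable_mulq (cp p) df) (cp q)).
by rewrite (derive_mulq _ (cp p) df) !dr mul0q mulq0 add0r addr0.
Qed.

Lemma derive_conjq f x v : differentiable f x ->
  'D_v (fun y => conjq (f y)) x = conjq ('D_v f x).
Proof.
move=> df; rewrite conjq_funE.
have S p q := diff_derivable (v := v) (differentiable_sandwich p q df).
have D := diff_derivable (v := v) df.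
have D1 := derivableD D (S qi qi).
have D2 := derivableD D1 (S qj qj).
rewrite (deriveZ _ (derivableD D2 (S qk qk))) (deriveD D2 (S _ _)).
by rewrite (deriveD D1 (S _ _)) (deriveD D (S _ _)) !derive_sandwich// -conjq_mulq.
Qed.

(** A class of differentiable maps closed under directional derivatives, so that smoothness is an
    induction on the list of directions. Real scaling and conjugation arise from sums and products
    with constants. *)
Inductive qpoly : (quat3 -> quat) -> Prop :=
| qpoly_cst c : qpoly (fun=> c)
| qpoly_proj1 : qpoly (fun x => x.1.1)
| qpoly_proj2 : qpoly (fun x => x.1.2)
| qpoly_proj3 : qpoly (fun x => x.2)
| qpolyD f g : qpoly f -> qpoly g -> qpoly (fun x => f x + g x)
| qpolyM f g : qpoly f -> qpoly g -> qpoly (fun x => mulq (f x) (g x)).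

Lemma qpolyZ k f : qpoly f -> qpoly (fun x => k *: f x).
Proof.
move=> pf; have := qpolyM (qpoly_cst (k *: quat1)) pf.
by congr qpoly; apply/funext => x; rewrite mulqZl mul1q.
Qed.

Lemma qpoly_conj f : qpoly f -> qpoly (fun x => conjq (f x)).
Proof.
move=> pf; rewrite conjq_funE; apply: qpolyZ.
have S p q : qpoly (fun y => mulq (mulq p (f y)) q).
  by apply: qpolyM (qpoly_cst _); apply: qpolyM pf; exact: qpoly_cst.
by apply: qpolyD => //; apply: qpolyD => //; apply: qpolyD.
Qed.

(** A continuous linear map is its own differential; the unbundled [h] is packed with its linear
    structure to say so. *)
Lemma linear_derive (W : normedModType R) (h : quat3 -> W) x v :
  linear h -> continuous h -> differentiable h x /\ 'D_v h x = h v.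
Proof.
move=> lh ch.
pose hM := GRing.isLinear.Build _ _ _ _ _ lh.
pose hL : {linear quat3 -> W} := HB.pack h hM.
have dh : differentiable h x := @linear_differentiable _ _ _ hL x ch.
split=> //; rewrite deriveE//.
exact: (congr1 (fun k => k v) (@diff_lin _ _ _ hL x ch)).
Qed.

Lemma continuous_proj1 : continuous (fun y : quat3 => y.1.1).
Proof. by move=> y; apply: (cvg_comp _ _ cvg_fst cvg_fst). Qed.

Lemma continuous_proj2 : continuous (fun y : quat3 => y.1.2).
Proof. by move=> y; apply: (cvg_comp _ _ cvg_fst cvg_snd). Qed.

Lemma continuous_proj3 : continuous (fun y : quat3 => y.2).
Proof. by move=> y; exact: cvg_snd. Qed.

Lemma derive_proj1 x v : 'D_v (fun y : quat3 => y.1.1) x = v.1.1.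
Proof. by apply: (proj2 (linear_derive _ _ _ continuous_proj1)). Qed.

Lemma derive_proj2 x v : 'D_v (fun y : quat3 => y.1.2) x = v.1.2.
Proof. by apply: (proj2 (linear_derive _ _ _ continuous_proj2)). Qed.

Lemma derive_proj3 x v : 'D_v (fun y : quat3 => y.2) x = v.2.
Proof. by apply: (proj2 (linear_derive _ _ _ continuous_proj3)). Qed.

Lemma differentiable_proj3 x : differentiable (fun y : quat3 => y.2) x.
Proof. by apply: (proj1 (linear_derive x 0 _ continuous_proj3)). Qed.

Lemma qpoly_differentiable f x : qpoly f -> differentiable f x.
Proof.
elim=> {f} [c||||f g _ df _ dg|f g _ df _ dg].
- exact: differentiable_cst.
- by apply: (proj1 (linear_derive x 0 _ continuous_proj1)).
- by apply: (proj1 (linear_derive x 0 _ continuous_proj2)).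
- exact: differentiable_proj3.
- exact: differentiableD.
- exact: differentiable_mulq.
Qed.

Lemma qpoly_derive f v : qpoly f -> qpoly (fun x => 'D_v f x).
Proof.
elim=> {f} [c||||f g pf IHf pg IHg|f g pf IHf pg IHg].
- rewrite (_ : (fun x => _) = fun=> 0); first exact: qpoly_cst.
  by apply/funext => x; exact: derive_cst.
- under eq_fun do rewrite derive_proj1; exact: qpoly_cst.
- under eq_fun do rewrite derive_proj2; exact: qpoly_cst.
- under eq_fun do rewrite derive_proj3; exact: qpoly_cst.
- have := qpolyD IHf IHg; congr qpoly; apply/funext => x.
  by rewrite [RHS]deriveD//; apply: diff_derivable; exact: qpoly_differentiable.
- have := qpolyD (qpolyM IHf pg) (qpolyM pf IHg); congr qpoly; apply/funext => x.
  by rewrite derive_mulq//; exact: qpoly_differentiable.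
Qed.

Lemma qpoly_smooth f : qpoly f -> smooth f.
Proof.
move=> pf us x; apply: qpoly_differentiable; elim: us => //= u us.
exact: qpoly_derive.
Qed.

End Calculus.

(** * The limit connection and its curvature *)

Section Connection.
Context {R : realType}.
Local Notation quat := (quat (R := R)).
Local Notation quat3 := (quat3 (R := R)).
Implicit Types (x u v w : quat3).

(* [- (2/3) g3 psi g3^-1] on (S^3)^3, with each [g^-1] replaced by the conjugate so
   that the form is polynomial, hence smooth, on all of H^3 *)
Definition limit_connection : diff_form (R := R) 1 quat := fun x (v : 'I_1 -> quat3) =>
  - (2 / 3) *: (mulq (v ord0).2 (conjq x.2) +
    (- 2^-1) *: mulq (mulq x.2 (mulq (conjq x.1.1) (v ord0).1.1 +
                                mulq (conjq x.1.2) (v ord0).1.2)) (conjq x.2)).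

Local Notation At := limit_connection.

Lemma S3_cancel (g p : quat) : S3 g -> mulq (conjq g) (mulq g p) = p.
Proof. by move=> Sg; rewrite mulqA S3_mul_conjq// mul1q. Qed.

Lemma S3_cancel_conj (g p : quat) : S3 g -> mulq g (mulq (conjq g) p) = p.
Proof. by move=> Sg; rewrite mulqA S3_mulq_conj// mul1q. Qed.

Lemma S3_mulq (p q : quat) : S3 p -> S3 q -> S3 (mulq p q).
Proof. by rewrite /S3 /= normqM => -> ->; rewrite mulr1. Qed.

Lemma theta_imaginary (g u : quat) : S3 g -> tangentS3 g u ->
  imaginary (mulq (invq g) u).
Proof. by move=> Sg; rewrite S3_invq//; exact: tangentS3_imaginary. Qed.

Lemma imaginaryD (p q : quat) : imaginary p -> imaginary q -> imaginary (p + q).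
Proof. by rewrite /imaginary /qre mxE => -> ->; rewrite addr0. Qed.

Lemma imaginaryZ k (p : quat) : imaginary p -> imaginary (k *: p).
Proof. by rewrite /imaginary /qre mxE => ->; rewrite mulr0. Qed.

Lemma imaginaryN (p : quat) : imaginary p -> imaginary (- p).
Proof. by rewrite -scaleN1r; exact: imaginaryZ. Qed.

Lemma phi_imaginary x v : S3 x.1.1 -> S3 x.1.2 ->
  tangentS3 x.1.1 v.1.1 -> tangentS3 x.1.2 v.1.2 -> imaginary (ev1 phi x v).
Proof.
by move=> ? ? ? ?; apply: imaginaryZ; apply: imaginaryD; exact: theta_imaginary.
Qed.

Lemma psi_imaginary x v : linkN x -> tangentN x v -> imaginary (ev1 psi x v).
Proof.
move=> [S1 [S2 S3x]] [T1 T2 T3]; apply: imaginaryD; first exact: theta_imaginary.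
by apply: imaginaryN; exact: phi_imaginary.
Qed.

Lemma omega_imaginary x v : linkN x -> tangentN x v -> imaginary (ev1 omega x v).
Proof.
move=> [S1 [S2 S3x]] [T1 T2 T3]; apply: imaginaryD; first exact: theta_imaginary.
by apply: imaginaryN; exact: theta_imaginary.
Qed.

(** On [linkN] conjugates are inverses, so [dg3 g3^-1] is [g3 theta3 g3^-1] and the polynomial
    formula becomes the geometric one. *)
Lemma limit_connection_psi x v : linkN x ->
  ev1 At x v = - (2 / 3) *: mulq (mulq x.2 (ev1 psi x v)) (conjq x.2).
Proof.
move=> [S1 [S2 S3x]]; rewrite /ev1 /At /psi /phi /theta1 /theta2 /theta3 /=.
rewrite !S3_invq// [in RHS]mulqDr mulqNr mulqZr S3_cancel_conj//.
by rewrite [in RHS]mulqDl mulqNl mulqZl !scaleNr.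
Qed.

Lemma su2_limit_connection : su2_connection At.
Proof.
split.
- move=> u; apply: qpoly_smooth; apply: qpolyZ; apply: qpolyD.
    by apply: qpolyM (qpoly_conj qpoly_proj3); exact: qpoly_cst.
  apply: qpolyZ; apply: qpolyM (qpoly_conj qpoly_proj3).
  apply: qpolyM qpoly_proj3 _; apply: qpolyD.
    by apply: qpolyM (qpoly_conj qpoly_proj1) (qpoly_cst _).
  by apply: qpolyM (qpoly_conj qpoly_proj2) (qpoly_cst _).
- move=> x c u v; rewrite /ev1 /At /= !(mulq_linear, mulq_linearl).
  rewrite ![mulq _ (_ + _)]mulqDr ![mulq _ (_ *: _)]mulqZr.
  rewrite ![mulq (_ + _) _]mulqDl ![mulq (_ *: _) _]mulqZl.
  (* The products are generalized, since the remaining identity is linear in them. *)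
  repeat match goal with |- context [mulq ?p ?q] => move: (mulq p q) end.
  by quat_ring.
- move=> x u Nx Tu; rewrite limit_connection_psi//; apply: imaginaryZ.
  by apply: imaginary_conjugate; exact: psi_imaginary.
- move=> x xi Nx _; rewrite limit_connection_psi//.
  have [S1 [S2 S3x]] := Nx.
  rewrite /ev1 /psi /phi /theta1 /theta2 /theta3 /= !S3_invq// !S3_cancel//.
  (* Along the orbit all three [theta] take the value [xi], hence so does [phi], and [psi]
     vanishes. *)
  rewrite scalerDr -scalerDl (_ : 2^-1 + 2^-1 = 1 :> R); last by lra.
  by rewrite scale1r subrr mulq0 mul0q scaler0.
- move=> x u q Nx Tu Sq; have [S1 [S2 S3x]] := Nx.
  have Nxq : linkN (act3 x q) by split=> /=; [|split]; exact: S3_mulq.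
  rewrite !limit_connection_psi//.
  have [? [? ?]] := Nxq.
  rewrite /ev1 /psi /phi /theta1 /theta2 /theta3 /= !S3_invq// !conjqM.
  congr (_ *: _).
  (* Right translation turns each [theta] into [q^-1 theta q]; these factors then cancel against the
     [q] in the third component. *)
  have E p r : mulq (mulq (conjq q) p) (mulq r q) = mulq (mulq (conjq q) (mulq p r)) q.
    by rewrite -!mulqA.
  rewrite !E -mulqDl -mulqDr -mulqZl -mulqZr -mulqNl -mulqNr -mulqDl -mulqDr.
  by rewrite -!mulqA !S3_cancel_conj.
Qed.

(** Product rule in H^3 with the vector [w] held constant, as in [extd]. *)
Lemma derive_limit_connection x u w :
  'D_u (fun y => At y (fun=> w)) x = - (2 / 3) *:
   (mulq w.2 (conjq u.2) + (- 2^-1) *: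
     (mulq (mulq u.2 (mulq (conjq x.1.1) w.1.1 + mulq (conjq x.1.2) w.1.2)) (conjq x.2)
    + mulq (mulq x.2 (mulq (conjq u.1.1) w.1.1 + mulq (conjq u.1.2) w.1.2)) (conjq x.2)
    + mulq (mulq x.2 (mulq (conjq x.1.1) w.1.1 + mulq (conjq x.1.2) w.1.2)) (conjq u.2))).
Proof.
have d1 := qpoly_differentiable x qpoly_proj1.
have d2 := qpoly_differentiable x qpoly_proj2.
have d3 := qpoly_differentiable x qpoly_proj3.
have dc (p : quat) : differentiable (fun=> p) x := differentiable_cst _ _.
have c1 := differentiable_conjq d1.
have c2 := differentiable_conjq d2.
have c3 := differentiable_conjq d3.
have m1 := differentiable_mulq c1 (dc w.1.1).
have m2 := differentiable_mulq c2 (dc w.1.2).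
have s12 := differentiableD m1 m2.
have a3 := differentiable_mulq d3 s12.
have b3 := differentiable_mulq a3 c3.
have e3 := differentiable_mulq (dc w.2) c3.
have Dc (p : quat) : 'D_u (fun=> p) x = 0 := derive_cst _ _ _.
have DD (f g : quat3 -> quat) : differentiable f x -> differentiable g x ->
    'D_u (fun y => f y + g y) x = 'D_u f x + 'D_u g x.
  by move=> df dg; apply: deriveD; exact: diff_derivable.
have DZ k (f : quat3 -> quat) : differentiable f x ->
    'D_u (fun y => k *: f y) x = k *: 'D_u f x.
  by move=> df; apply: deriveZ; exact: diff_derivable.
rewrite [LHS](DZ _ _ (differentiableD e3 (differentiableZ (- 2^-1) b3))); congr (_ *: _).
rewrite (DD _ _ e3 (differentiableZ (- 2^-1) b3)) (DZ _ _ b3).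
rewrite (derive_mulq _ (dc w.2) c3) derive_conjq// derive_proj3 Dc mul0q add0r.
rewrite (derive_mulq _ a3 c3) (derive_mulq _ d3 s12) (DD _ _ m1 m2).
rewrite (derive_mulq _ c1 (dc _)) (derive_mulq _ c2 (dc _)) !Dc !mulq0 !addr0.
by rewrite !derive_conjq// derive_proj1 derive_proj2 derive_proj3 mulqDl.
Qed.

Lemma sum_perm2 (V : nmodType) (F : 'S_2 -> V) :
  \sum_s F s = F 1%g + F (tperm ord0 ord_max).
Proof.
have ord2 (i : 'I_2) : i = ord0 \/ i = ord_max.
  by case: i => [[|[|//]] lti]; [left|right]; apply: val_inj.
have ne : tperm ord0 ord_max != 1%g :> 'S_2.
  by apply/eqP => /permP/(_ ord0); rewrite tpermL perm1.
rewrite (bigD1 1%g)//= (bigD1 (tperm ord0 ord_max))//= big1 ?addr0// => s.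
move=> /andP[/eqP s1 /eqP st].
case: (ord2 (s ord0)) (ord2 (s ord_max)) => [s0|s0] [sm|sm].
- by have := perm_inj (etrans s0 (esym sm)).
- by case: s1; apply/permP => i; rewrite perm1; case: (ord2 i) => ->.
- case: st; apply/permP => i.
  by case: (ord2 i) => ->; rewrite ?tpermL ?tpermR.
- by have := perm_inj (etrans s0 (esym sm)).
Qed.

Lemma wedge11 (A B : diff_form (R := R) 1 quat) x (v : 'I_2 -> quat3) :
  wedgeQ A B x v =
  mulq (ev1 A x (v ord0)) (ev1 B x (v ord_max)) -
  mulq (ev1 A x (v ord_max)) (ev1 B x (v ord0)).
Proof.
rewrite /wedgeQ /wedge (_ : (1`! * 1`!)%N = 1%N)// invr1 scale1r sum_perm2.
rewrite odd_perm1 odd_tperm expr0 expr1 scale1r scaleN1r /ev1.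
have L (i : 'I_1) : lshift 1 i = ord0 by apply: val_inj; rewrite (ord1 i).
have M (i : 'I_1) : rshift 1 i = ord_max by apply: val_inj; rewrite (ord1 i).
congr (mulq (A x _) (B x _) - mulq (A x _) (B x _)); apply/funext => i;
  by rewrite ?L ?M ?perm1 ?tpermL ?tpermR.
Qed.

(* The curvature identity at a pair of tangent vectors: [ai], [bi] are the values of
   [theta_i] on the first and on the second one. *)
Lemma maurer_cartan_curvature (b1 a1 b2 a2 b3 a3 : quat) :
  - (2 / 3) *:
    (- mulq b3 a3 + - 2^-1 *: (mulq a3 (b1 + b2) - (mulq a1 b1 + mulq a2 b2)
      - mulq (b1 + b2) a3)
   - (- mulq a3 b3 + - 2^-1 *: (mulq b3 (a1 + a2) - (mulq b1 a1 + mulq b2 a2)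
      - mulq (a1 + a2) b3)))
  + (- (2 / 3)) ^+ 2 *:
     (mulq (a3 - 2^-1 *: (a1 + a2)) (b3 - 2^-1 *: (b1 + b2))
    - mulq (b3 - 2^-1 *: (b1 + b2)) (a3 - 2^-1 *: (a1 + a2))) =
  - 6^-1 *: (mulq (a1 - a2) (b1 - b2) - mulq (b1 - b2) (a1 - a2))
  - (2 / 9) *:
     (mulq (a3 - 2^-1 *: (a1 + a2)) (b3 - 2^-1 *: (b1 + b2))
    - mulq (b3 - 2^-1 *: (b1 + b2)) (a3 - 2^-1 *: (a1 + a2))).
Proof.
case: (quat_mk b1) => ? [? [? [? ->]]]; case: (quat_mk a1) => ? [? [? [? ->]]].
case: (quat_mk b2) => ? [? [? [? ->]]]; case: (quat_mk a2) => ? [? [? [? ->]]].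
case: (quat_mk b3) => ? [? [? [? ->]]]; case: (quat_mk a3) => ? [? [? [? ->]]].
rewrite ?qmk; congr mkq; lra.
Qed.

(** Conjugation by a unit [g] is an algebra automorphism, so it factors out of the curvature. In the
    application [p] and [q] come from the two derivatives and [r] and [s] are values of [psi]. *)
Lemma curvature_sandwich (g p q r s : quat) k : S3 g ->
  k *: mulq (mulq g p) (conjq g) - k *: mulq (mulq g q) (conjq g) +
  (mulq (k *: mulq (mulq g r) (conjq g)) (k *: mulq (mulq g s) (conjq g)) -
   mulq (k *: mulq (mulq g s) (conjq g)) (k *: mulq (mulq g r) (conjq g))) =
  mulq (mulq g (k *: (p - q) + k ^+ 2 *: (mulq r s - mulq s r))) (conjq g).
Proof.
move=> Sg.
have conjM (u w : quat) : mulq (mulq (mulq g u) (conjq g)) (mulq (mulq g w) (conjq g)) =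
    mulq (mulq g (mulq u w)) (conjq g) by rewrite -!mulqA S3_cancel.
rewrite !mulqZl !mulqZr !conjM mulqDr mulqDl !mulqZr !mulqZl.
rewrite !mulqDr !mulqDl !mulqNr !mulqNl !scalerDr !scalerN !scalerA.
by rewrite expr2.
Qed.

Lemma curvature_limit_connection x (v : 'I_2 -> quat3) :
  linkN x -> (forall i, tangentN x (v i)) ->
  curvature At x v = mulq (mulq x.2
    (- 6^-1 *: wedgeQ omega omega x v - (2 / 9) *: wedgeQ psi psi x v)) (conjq x.2).
Proof.
move=> Nx Tv; have [S1 [S2 S3x]] := Nx.
(* The derivative in terms of left-translated vectors, with conjugation by [x.2] pulled out. *)
have E u w : tangentN x u -> tangentN x w ->
  let a1 := mulq (conjq x.1.1) u.1.1 in let b1 := mulq (conjq x.1.1) w.1.1 in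
  let a2 := mulq (conjq x.1.2) u.1.2 in let b2 := mulq (conjq x.1.2) w.1.2 in
  let a3 := mulq (conjq x.2) u.2 in let b3 := mulq (conjq x.2) w.2 in
  'D_u (fun y => At y (fun=> w)) x = - (2 / 3) *: mulq (mulq x.2
    (- mulq b3 a3 + (- 2^-1) *: (mulq a3 (b1 + b2) - (mulq a1 b1 + mulq a2 b2)
       - mulq (b1 + b2) a3))) (conjq x.2).
  move=> [T1 T2 T3] [_ _ _] /=; rewrite derive_limit_connection.
  set a1 := mulq (conjq x.1.1) u.1.1; set b1 := mulq (conjq x.1.1) w.1.1.
  set a2 := mulq (conjq x.1.2) u.1.2; set b2 := mulq (conjq x.1.2) w.1.2.
  set a3 := mulq (conjq x.2) u.2; set b3 := mulq (conjq x.2) w.2.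
  (* This is [d(g^-1) = - g^-1 dg g^-1]; it holds because [mulq (conjq g) p] is imaginary. *)
  have conj_u (g p : quat) : S3 g -> tangentS3 g p ->
      conjq p = - mulq (mulq (conjq g) p) (conjq g).
    move=> Sg Tp; rewrite -{1}(S3_cancel_conj p Sg) conjqM.
    by rewrite (imaginary_conj (tangentS3_imaginary Tp)) mulqNl.
  rewrite (conj_u _ _ S1 T1) (conj_u _ _ S2 T2) (conj_u _ _ S3x T3).
  rewrite -/a1 -/a2 -/a3 !mulqNl -!mulqA -/b1 -/b2.
  rewrite -{1}(S3_cancel_conj u.2 S3x) -{1}(S3_cancel_conj w.2 S3x) -/a3 -/b3.
  have Kx p : mulq (mulq p (conjq x.2)) x.2 = p by rewrite -mulqA S3_mul_conjq// mulq1.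
  rewrite !(mulqDl, mulqDr, mulqNl, mulqNr, mulqZl, mulqZr, mulqA) Kx.
  rewrite !(S3_mulq_conj S3x) !mul1q.
  repeat match goal with |- context [mulq ?p ?q] => move: (mulq p q) end.
  by quat_ring.
rewrite /curvature wedge11 /extd big_ord_recl big_ord1 /=.
rewrite expr0 expr1 scale1r scaleN1r.
(* Omitting one of two indices leaves the constant family at the other vector. *)
have -> : (fun j => v (lift ord0 j)) = (fun _ : 'I_1 => v ord_max).
  by apply/funext => j; congr v; apply: val_inj; rewrite (ord1 j).
have -> : lift ord0 ord0 = ord_max :> 'I_2 by apply: val_inj.
have -> : (fun j => v (lift ord_max j)) = (fun _ : 'I_1 => v ord0).
  by apply/funext => j; congr v; apply: val_inj; rewrite (ord1 j).
rewrite !E// !limit_connection_psi// !wedge11.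
rewrite curvature_sandwich//; congr (mulq (mulq _ _) _).
rewrite /ev1 /omega /psi /phi /theta1 /theta2 /theta3 !S3_invq//.
exact: (maurer_cartan_curvature
  (mulq (conjq x.1.1) (v ord_max).1.1) (mulq (conjq x.1.1) (v ord0).1.1)
  (mulq (conjq x.1.2) (v ord_max).1.2) (mulq (conjq x.1.2) (v ord0).1.2)
  (mulq (conjq x.2) (v ord_max).2) (mulq (conjq x.2) (v ord0).2)).
Qed.

End Connection.

(** * The Hermitian Yang-Mills equations *)

Section HermitianYangMills.
Context {R : realType}.
Local Notation quat := (quat (R := R)).
Local Notation quat3 := (quat3 (R := R)).
Implicit Types (x u : quat3).

(* the components of [omega] at indices 0, 1, 2 and of [psi] at 3, 4, 5 *)
Definition coframe x (a : nat) u : R :=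
  [:: qim (ev1 omega x u) 0; qim (ev1 omega x u) 1; qim (ev1 omega x u) 2;
      qim (ev1 psi x u) 0; qim (ev1 psi x u) 1; qim (ev1 psi x u) 2]`_a.

Local Notation rep_at x := (rep (coframe x) (tangentN x) x).

Lemma mono1 (e : nat -> quat3 -> R) a (v : 'I_1 -> quat3) : mono e [:: a] v = e a (v ord0).
Proof. by rewrite /mono det_mx11 mxE. Qed.

(** On tangent vectors the real part vanishes, so three components suffice; this is why [rep] is
    restricted by a predicate on vectors. *)
Lemma rep_imaginary x (A : diff_form (R := R) 1 quat) a b c :
  (forall u, tangentN x u -> imaginary (ev1 A x u)) ->
  (forall u, qim (ev1 A x u) 0 = coframe x a u) ->
  (forall u, qim (ev1 A x u) 1 = coframe x b u) ->
  (forall u, qim (ev1 A x u) 2 = coframe x c u) ->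
  rep_at x A [:: ([:: a], qi); ([:: b], qj); ([:: c], qk)].
Proof.
move=> imA Aa Ab Ac; split=> // v Pv.
rewrite /msum !big_cons big_nil addr0 /= !mono1 -Aa -Ab -Ac.
have -> : A x v = ev1 A x (v ord0).
  by rewrite /ev1; congr (A x _); apply/funext => i; rewrite (ord1 i).
have := imA _ (Pv ord0); move: (ev1 A x (v ord0)) => p.
case: (quat_mk p) => r [s [t [z ->]]]; rewrite /imaginary qre_mkq => ->.
rewrite /qi /qj /qk !qmk; congr mkq; ring.
Qed.

Lemma rep_omega x : linkN x ->
  rep_at x omega [:: ([:: 0%N], qi); ([:: 1%N], qj); ([:: 2%N], qk)].
Proof. by move=> Nx; apply: rep_imaginary => // u; exact: omega_imaginary. Qed.

Lemma rep_psi x : linkN x ->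
  rep_at x psi [:: ([:: 3%N], qi); ([:: 4%N], qj); ([:: 5%N], qk)].
Proof. by move=> Nx; apply: rep_imaginary => // u; exact: psi_imaginary. Qed.

Lemma rep_im_omega x (i : 'I_3) :
  rep_at x (imF i omega) [:: ([:: val i], 1 : R^o)].
Proof.
split=> // v Pv; rewrite /msum big_seq1 mono1 /=.
rewrite /imF (_ : omega x v = ev1 omega x (v ord0)); last first.
  by rewrite /ev1; congr (omega x _); apply/funext => j; rewrite (ord1 j).
rewrite /coframe -[X in qim _ X](inord_val i).
case: i => [[|[|[|//]]] lti] /=; rewrite /GRing.scale /= mulr1;
 congr (qim _ _); apply: val_inj; rewrite /= inordK//.
Qed.

Lemma rep_wedgeQ x p q (A : diff_form p quat) (B : diff_form q quat) g h :
  rep_at x A g -> rep_at x B h ->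
  rep_at x (wedgeQ A B) [seq (a.1 ++ b.1, mulq a.2 b.2) | a <- g, b <- h].
Proof.
by apply: rep_wedge => *; [exact: mulq_linear|exact: mulq_linearl].
Qed.

Lemma rep_wedgeR x p q (A : diff_form p R^o) (B : diff_form q R^o) g h :
  rep_at x A g -> rep_at x B h ->
  rep_at x (wedgeR A B) [seq (a.1 ++ b.1, a.2 * b.2 : R^o) | a <- g, b <- h].
Proof.
apply: rep_wedge => a c u w; rewrite /GRing.scale /=; ring.
Qed.

Lemma rep_wedgeQR x p q (A : diff_form p quat) (B : diff_form q R^o) g h :
  rep_at x A g -> rep_at x B h ->
  rep_at x (wedgeQR A B) [seq (a.1 ++ b.1, b.2 *: a.2) | a <- g, b <- h].
Proof.
apply: rep_wedge => a c u w; rewrite /= ?scalerDl ?scalerDr ?scalerA//.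
by rewrite mulrC.
Qed.

Lemma rep_re x k (A : diff_form k quat) g :
  rep_at x A g -> rep_at x (reF A) [seq (t.1, qre t.2 : R^o) | t <- g].
Proof. by apply: rep_map => c u w; rewrite /qre !mxE. Qed.

Lemma rep_scale x k c (U : lmodType R) (A : diff_form k U) g :
  rep_at x A g ->
  rep_at x (fun y v => c *: A y v) [seq (t.1, c *: t.2) | t <- g].
Proof. by apply: rep_map => d u w; rewrite scalerDr !scalerA mulrC. Qed.

(** The sign comes from [i^2 = -1]: the real part of [omega /\ psi] is minus the sum of the
    [omega^i /\ psi^i]. *)
Lemma rep_varpi x : linkN x ->
  rep_at x varpi [seq (l, - (2 / (3 * Num.sqrt 3)) : R^o) |
    l <- [:: [:: 0; 3]; [:: 1; 4]; [:: 2; 5]]%N].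
Proof.
move=> Nx.
have := rep_scale (2 / (3 * Num.sqrt 3)) (rep_re (rep_wedgeQ (rep_omega Nx) (rep_psi Nx))).
apply: rep_normal => // v.
rewrite /msum /normal_form /qi /qj /qk /=.
rewrite !big_cons !big_nil /= !qmk.
rewrite /GRing.scale /=; ring.
Qed.

(** As [psi /\ psi] is [2 psi^23 i] plus cyclic terms, the second summand contributes [- (4 / 9)]
    for each cyclic monomial; the middle one changes sign when [psi^31] is sorted. *)
Lemma rep_Omega1 x : linkN x ->
  rep_at x Omega1 [seq (l.1, l.2 * (Num.sqrt 3)^-1 : R^o) | l <-
    [:: ([:: 0; 1; 2], 3^-1); ([:: 0; 4; 5], - (4 / 9));
        ([:: 1; 3; 5], 4 / 9); ([:: 2; 3; 4], - (4 / 9))]%N].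
Proof.
move=> Nx.
have := rep_add
  (rep_scale (1 / (3 * Num.sqrt 3)) (rep_wedgeR (rep_wedgeR
     (rep_im_omega x 0) (rep_im_omega x 1)) (rep_im_omega x 2)))
  (rep_scale (2 / (9 * Num.sqrt 3)) (rep_re (rep_wedgeQ (rep_omega Nx)
     (rep_wedgeQ (rep_psi Nx) (rep_psi Nx))))).
apply: rep_normal => // v.
rewrite /msum /normal_form /qi /qj /qk /= !big_cons !big_nil /= !qmk.
rewrite /GRing.scale /= !invfM; lra.
Qed.

(** The real part of [psi^3] is [-6 psi^123], and that of [omega^2 /\ psi] is [-2] times the cyclic
    sum of [omega^23 /\ psi^1], whose middle term changes sign when sorted. *)
Lemma rep_Omega2 x : linkN x ->
  rep_at x Omega2 [:: ([:: 3; 4; 5]%N, 8 / 27 : R^o); ([:: 1; 2; 3]%N, - (2 / 9));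
        ([:: 0; 2; 4]%N, 2 / 9); ([:: 0; 1; 5]%N, - (2 / 9))].
Proof.
move=> Nx.
have := rep_add
  (rep_scale (- (4 / 81)) (rep_re (rep_wedgeQ
     (rep_wedgeQ (rep_psi Nx) (rep_psi Nx)) (rep_psi Nx))))
  (rep_scale (1 / 9) (rep_re (rep_wedgeQ
     (rep_wedgeQ (rep_omega Nx) (rep_omega Nx)) (rep_psi Nx)))).
apply: rep_normal => // v.
rewrite /msum /normal_form /qi /qj /qk /= !big_cons !big_nil /= !qmk.
rewrite /GRing.scale /=; lra.
Qed.

(** Squaring [omega] and [psi] doubles the cyclic products, whence [2 / 6] and [4 / 9]. Conjugation
    by [x.2] is linear and acts on coefficients only, so the list is simplified before it is
    applied. *)
Lemma rep_curvature x : linkN x ->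
  rep_at x (curvature limit_connection)
    [seq (t.1, mulq (mulq x.2 t.2) (conjq x.2)) | t <-
      [:: ([:: 1; 2]%N, - 3^-1 *: qi); ([:: 0; 2]%N, 3^-1 *: qj);
          ([:: 0; 1]%N, - 3^-1 *: qk); ([:: 4; 5]%N, - (4 / 9) *: qi);
          ([:: 3; 5]%N, (4 / 9) *: qj); ([:: 3; 4]%N, - (4 / 9) *: qk)]].
Proof.
move=> Nx.
pose F : diff_form 2 quat := fun y v => - 6^-1 *: wedgeQ omega omega y v
  + - (2 / 9) *: wedgeQ psi psi y v.
have rF := rep_add (rep_scale (- 6^-1) (rep_wedgeQ (rep_omega Nx) (rep_omega Nx)))
  (rep_scale (- (2 / 9)) (rep_wedgeQ (rep_psi Nx) (rep_psi Nx))).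
have [sg Fg] : rep_at x (fun y v => mulq (mulq x.2 (F y v)) (conjq x.2))
    [seq (t.1, mulq (mulq x.2 t.2) (conjq x.2)) | t <-
      [:: ([:: 1; 2]%N, - 3^-1 *: qi); ([:: 0; 2]%N, 3^-1 *: qj);
          ([:: 0; 1]%N, - 3^-1 *: qk); ([:: 4; 5]%N, - (4 / 9) *: qi);
          ([:: 3; 5]%N, (4 / 9) *: qj); ([:: 3; 4]%N, - (4 / 9) *: qk)]].
  apply: (rep_map (f := fun p => mulq (mulq x.2 p) (conjq x.2))).
    by move=> c u w; rewrite mulq_linear mulq_linearl.
  move: rF; apply: rep_normal => // v.
  rewrite /msum /normal_form /qi /qj /qk /= !big_cons !big_nil /= !qmk.
  by congr mkq; lra.
split=> // v Tv; rewrite curvature_limit_connection// -Fg//.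
by rewrite /F !scaleNr.
Qed.

Lemma hermitian_yang_mills_limit_connection : hermitian_yang_mills (limit_connection (R := R)).
Proof.
split=> x v Nx Tv.
- have [sg ->//] := rep_wedgeQR (rep_curvature Nx)
    (rep_wedgeR (rep_varpi Nx) (rep_varpi Nx)).
  (* A nonzero monomial of [varpi /\ varpi] fills two of the couples 03, 14, 25, and each curvature
     monomial meets two couples. Some index is always repeated, so the normal form is empty. *)
  by rewrite -msum_normal_form// /msum /normal_form /= big_nil.
- have [sg ->//] := rep_wedgeQR (rep_curvature Nx) (rep_Omega1 Nx).
  (* In the [i] component the two surviving terms share the monomial 01245, with coefficients
     [4 / 27] and [- (4 / 27)] over [Num.sqrt 3]; [j] and [k] are alike. *)
  rewrite -msum_normal_form// /msum /normal_form /= !big_cons big_nil /=.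
  rewrite !mulqZr !mulqZl.
  (* The terms cancel within each component, so the conjugates of [i], [j], [k] may be replaced by
     arbitrary quaternions. *)
  move: (mulq (mulq x.2 qi) (conjq x.2)) (mulq (mulq x.2 qj) (conjq x.2))
    (mulq (mulq x.2 qk) (conjq x.2)).
  by quat_ring.
- have [sg ->//] := rep_wedgeQR (rep_curvature Nx) (rep_Omega2 Nx).
  (* Now the [i] component has the monomial 12345 twice, with coefficients [- (8 / 81)] and
     [8 / 81]. *)
  rewrite -msum_normal_form// /msum /normal_form /= !big_cons big_nil /=.
  rewrite !mulqZr !mulqZl.
  move: (mulq (mulq x.2 qi) (conjq x.2)) (mulq (mulq x.2 qj) (conjq x.2))
    (mulq (mulq x.2 qk) (conjq x.2)).
  by quat_ring.
Qed.

Lemma limit_connection_not_flat : ~ flat_connection (limit_connection (R := R)).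
Proof.
move=> flat.
(* With both vectors in the third factor at this point, [omega] vanishes and [psi] takes the values
   [i] and [j], so the curvature is [- (2 / 9) (ij - ji) = - (4 / 9) k]. *)
pose x : quat3 := (quat1, quat1, quat1).
pose v (i : 'I_2) : quat3 := (0, 0, if i == ord0 then qi else qj).
have S1 : S3 (quat1 : quat).
  by rewrite /S3 /= /normq /quat1 sum_coord !mxE /= expr1n expr0n /= !addr0 sqrtr1.
have Nx : linkN x by [].
have Tv i : tangentN x (v i).
  split; rewrite /tangentS3 -/(dotq _ _) /= ?zeroq_mkq /quat1 ?dotq_mkq ?mulr0 ?addr0//.
  by case: ifP => _; rewrite dotq_mkq !mulr0 ?mul0r !addr0.
have := flat x v Nx Tv; rewrite curvature_limit_connection// !wedge11.
rewrite /ev1 /omega /psi /phi /theta1 /theta2 /theta3 /= !S3_invq//.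
have -> : conjq quat1 = quat1 :> quat by rewrite conjq_mkq oppr0.
rewrite !mul1q addr0 scaler0 !subr0 mulq0 subrr scaler0 sub0r mulq1.
rewrite /qi /qj !qmk => /(congr1 (fun p => qim p 2)); rewrite !qcoord.
by lra.
Qed.

End HermitianYangMills.

(** * Convergence at infinity *)

Section Asymptotics.
Context {R : realType}.
Local Notation quat := (quat (R := R)).
Local Notation quat3 := (quat3 (R := R)).
Implicit Types (x v : quat3).

Lemma normq_gt0 (p : quat) : p != 0 -> 0 < normq p.
Proof. by move=> p0; rewrite lt0r normq_eq0 p0 normq_ge0. Qed.

Lemma derive_normq x v : x.2 != 0 ->
  differentiable (fun y : quat3 => normq y.2) x /\
  'D_v (fun y : quat3 => normq y.2) x = dotq x.2 v.2 / normq x.2.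
Proof.
move=> x0; have n0 := normq_gt0 x0.
have d3 := differentiable_proj3 x.
have c3 := differentiable_conjq d3.
pose N2 (y : quat3) : R := mulq (conjq y.2) y.2 0 ord0.
have dm := differentiable_mulq c3 d3.
have dN2 : differentiable N2 x := differentiable_quat_coord ord0 dm.
have N2E y : N2 y = normq y.2 ^+ 2 by rewrite sqr_normq -qre_conjM.
have DN2 : 'D_v N2 x = 2 * dotq x.2 v.2.
  rewrite -[LHS](derive_quat v ord0 dm) (derive_mulq _ c3 d3) derive_conjq//.
  rewrite derive_proj3; move: x.2 v.2 => p q; rewrite -[LHS]/(qre _).
  by case: (quat_mk p) => ? [? [? [? ->]]]; case: (quat_mk q) => ? [? [? [? ->]]];
    rewrite !qmk; ring.
have NE : (fun y : quat3 => normq y.2) = (@Num.sqrt R) \o N2.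
  by apply/funext => y; rewrite /= N2E sqrtr_sqr ger0_norm// normq_ge0.
have dN : differentiable (fun y : quat3 => normq y.2) x.
  rewrite NE; apply: differentiable_comp => //.
  apply/derivable1_diffP.
  have h : 0 < N2 x by rewrite N2E exprn_gt0.
  by have [] := is_derive1_sqrt h.
split=> //.
have DN := diff_derivable (v := v) dN.
(* The chain rule served for differentiability only; the value of the derivative is read off from
   [N * N = N2]. *)
have NN : (fun y : quat3 => normq y.2) * (fun y : quat3 => normq y.2) = N2.
  by apply/funext => y; rewrite N2E expr2.
have := deriveM DN DN; rewrite NN DN2 /GRing.scale /=.
move: ('D_v _ x) => D E; apply: (mulIf (lt0r_neq0 n0)).
by rewrite divfK ?lt0r_neq0//; lra.
Qed.

Lemma derive_proj x v : x.2 != 0 ->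
  'D_v proj x = (v.1, (normq x.2)^-1 *: v.2
                      - (dotq x.2 v.2 / normq x.2 ^+ 3) *: x.2).
Proof.
move=> x0; have n0 := normq_gt0 x0.
have [dN DN] := derive_normq v x0.
have d3 := differentiable_proj3 x.
pose k (y : quat3) : R := (normq y.2)^-1.
have dk : differentiable k x by apply: differentiableV => //; rewrite lt0r_neq0.
have Dk : 'D_v k x = - (dotq x.2 v.2 / normq x.2 ^+ 3).
  have := deriveV (f := fun y : quat3 => normq y.2) (lt0r_neq0 n0)
    (diff_derivable (v := v) dN).
  rewrite DN -[X in 'D_v X x]/k => ->; rewrite /GRing.scale /=.
  by field; rewrite lt0r_neq0.
(* Scaling by [k] is written as a quaternion product, so that [derive_mulq] applies. *)
pose h y : quat := k y *: quat1.
have dh : differentiable h x by apply: differentiableZl.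
have Dh : 'D_v h x = 'D_v k x *: quat1.
  by rewrite deriveE// diffZl// -deriveE.
have [d1 D1] : differentiable (fun y : quat3 => y.1) x /\
    'D_v (fun y : quat3 => y.1) x = v.1.
  by apply: linear_derive => // y; exact: cvg_fst.
have dg := differentiable_mulq dh d3.
have -> : proj = (fun y : quat3 => (y.1, mulq (h y) y.2)).
  by apply/funext => y; rewrite /proj /h mulqZl mul1q.
rewrite deriveE; last exact: differentiable_pair.
rewrite diff_pair//= -!deriveE// D1 (derive_mulq _ dh d3) Dh Dk derive_proj3.
by rewrite /h !mulqZl !mul1q scaleNr addrC.
Qed.

(** * Comparison with the limit at one point of the end *)

Section Point.
Variables x v : quat3.
Hypotheses (Yx : totalY x) (Tv : tangentY x v) (x0 : x.2 != 0).

Let n := normq x.2.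
Let w : quat := n^-1 *: v.2 - (dotq x.2 v.2 / n ^+ 3) *: x.2.

Let n_neq0 : n != 0. Proof. by rewrite lt0r_neq0// normq_gt0. Qed.

Let dotqxx : dotq x.2 x.2 = n ^+ 2. Proof. by rewrite -sqr_normq. Qed.

Lemma S3_proj : S3 (proj x).2.
Proof.
rewrite /S3 /proj /= normqZ ger0_norm ?invr_ge0 ?normq_ge0//.
by rewrite mulVf.
Qed.

Lemma linkN_proj : linkN (proj x).
Proof. by case: Yx => ? ?; split=> //; split=> //; exact: S3_proj. Qed.

(** The derivative of [a / |a|] is [v.2 / |a|] with its radial part removed, hence orthogonal to
    [a]. *)
Lemma tangentN_proj : tangentN (proj x) ('D_v proj x).
Proof.
case: Tv => T1 T2; rewrite derive_proj//; split=> //=.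
rewrite /tangentS3 -/(dotq _ _) -/n dotqZl.
have -> (p q r : quat) : dotq p (q - r) = dotq p q - dotq p r.
  by move: p q r; quat_ring.
rewrite !dotqZr dotqxx; field; exact: n_neq0.
Qed.

(** The radial part of [da] contributes a real term to [a conj(alpha)], which [Imq] removes; the
    rest scales with the square of [|a|]. *)
Lemma A_1_proj : ev1 A_1 x v = - n ^+ 2 *:
  mulq (mulq (proj x).2 (ev1 psi (proj x) ('D_v proj x))) (conjq (proj x).2).
Proof.
have [S1 S2] := Yx; have [T1 T2] := Tv.
have imphi : imaginary (ev1 phi x v) by exact: phi_imaginary.
have -> : ev1 psi (proj x) ('D_v proj x) = mulq (conjq (proj x).2) w - ev1 phi x v.
  by rewrite /ev1 /psi /phi /theta1 /theta2 /theta3 derive_proj//= S3_invq//; exact: S3_proj.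
rewrite /ev1 /A_1 /alpha -/(ev1 phi x v); move: (ev1 phi x v) imphi => p imp.
rewrite mulqDr (S3_cancel_conj _ S3_proj) mulqNr mulqDl mulqNl /proj /= -/n /w.
(* The sign of the last term is positive because [p], the value of [phi], is imaginary and so
   [conjq p = - p]. *)
have -> : Imq (mulq x.2 (conjq (v.2 - mulq x.2 p))) = - mulq v.2 (conjq x.2) +
    dotq x.2 v.2 *: quat1 + mulq (mulq x.2 p) (conjq x.2).
  move: x.2 v.2 p imp => a b p.
  case: (quat_mk a) => ? [? [? [? ->]]]; case: (quat_mk b) => ? [? [? [? ->]]].
  case: (quat_mk p) => ? [? [? [? ->]]]; rewrite /imaginary qre_mkq => ->.
  by rewrite /quat1 !qmk; congr mkq; ring.
rewrite !(conjZq, mulqZr, mulqZl, mulqDl, mulqNl) mulq_conj dotqxx.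
move: (mulq v.2 _) (mulq (mulq x.2 p) _) => P Q.
case: (quat_mk P) => ? [? [? [? ->]]]; case: (quat_mk Q) => ? [? [? [? ->]]].
rewrite /quat1 !qmk; congr mkq; field; exact: n_neq0.
Qed.

Lemma instanton_sub_pullback C :
  ev1 (fun y u => instanton C y u - pullback_proj limit_connection y u) x v =
  (2 / 3 - f_C C x * n ^+ 2) *:
  mulq (mulq (proj x).2 (ev1 psi (proj x) ('D_v proj x))) (conjq (proj x).2).
Proof.
have E : ev1 (fun y u => instanton C y u - pullback_proj limit_connection y u) x v =
  f_C C x *: ev1 A_1 x v - ev1 limit_connection (proj x) ('D_v proj x) by [].
rewrite E A_1_proj limit_connection_psi; last exact: linkN_proj.
by rewrite scalerA -scalerBl; congr (_ *: _); ring.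
Qed.

Lemma normq_instanton_sub_pullback C :
  normq (ev1 (fun y u => instanton C y u - pullback_proj limit_connection y u) x v) =
  `|2 / 3 - f_C C x * n ^+ 2| * normq (ev1 psi (proj x) ('D_v proj x)).
Proof.
rewrite instanton_sub_pullback normqZ !normqM normq_conj.
by have -> : normq (proj x).2 = 1 := S3_proj; rewrite mul1r mulr1.
Qed.

(** The [rho] and [omega] terms of the cone metric are nonnegative and are discarded; since [psi] is
    imaginary, its three components give its full norm. *)
Lemma gcon_psi_le :
  4 / 9 * (rho x * normq (ev1 psi (proj x) ('D_v proj x))) ^+ 2 <= gcon x v v.
Proof.
have := psi_imaginary linkN_proj tangentN_proj.
rewrite exprMn sqr_normq /gcon /gNK.
move: (ev1 psi _ _) (ev1 omega _ _) (rho x) ('D_v rho x) => p q r d.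
rewrite /imaginary /dotq big_ord_recl -[p 0 ord0]/(qre p) => ->.
rewrite mul0r add0r; set P := (X in 4 / 9 * X + _).
rewrite -[X in _ * (_ * X) <= _]/P.
have : 0 <= \sum_(i < 3) qim q i * qim q i by apply: sumr_ge0 => i _; rewrite -expr2 sqr_ge0.
move: (\sum_(i < 3) qim q i * qim q i) => Q Q0.
have : 0 <= d * d by rewrite -expr2 sqr_ge0.
have : 0 <= r ^+ 2 * Q by rewrite mulr_ge0// sqr_ge0.
move: (r ^+ 2 : R) => e; move: (d * d : R) => f; lra.
Qed.

End Point.

(** With [t] the cube root of [1 + |a|^2], the difference equals
    [(2 / 3) (3 + C t) / (3 t^3 + C t)]. The bound on [C] makes the denominator at least [t^3],
    while the numerator grows only linearly. *)
Lemma instanton_coef_le C (t : R) : - 3 < C -> 2 <= t ->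
  `|2 / 3 - 2 / (3 * t ^+ 3 + C * t) * (t ^+ 3 - 1)| <= (2 + `|C|) / t.
Proof.
move=> C3 t2.
have t0 : 0 < t by lra.
have t3 : 4 * t <= t ^+ 3.
  by rewrite exprS mulrC ler_pM2l// expr2; nra.
have Ct : - 3 * t <= C * t by rewrite ler_pM2r// ltW.
have D0 : t ^+ 3 <= 3 * t ^+ 3 + C * t by lra.
have Dp : 0 < 3 * t ^+ 3 + C * t by lra.
rewrite (_ : 2 / 3 - _ = (2 / 3) * ((3 + C * t) / (3 * t ^+ 3 + C * t))); last first.
  by field; rewrite lt0r_neq0.
rewrite normrM (normf_div (3 + C * t)) (ger0_norm (ltW Dp)) (@ger0_norm _ (2 / 3)); last by lra.
rewrite mulrA ler_pdivrMr// [leRHS]mulrAC ler_pdivlMr//.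
have h1 : `|3 + C * t| <= 3 + `|C| * t.
  by rewrite (le_trans (ler_normD _ _))// normrM (gtr0_norm t0) normr_nat.
have C0 : 0 <= `|C| := normr_ge0 C.
apply: (@le_trans _ _ ((2 + `|C|) * t ^+ 3)); last by rewrite ler_wpM2l// addr_ge0.
apply: (@le_trans _ _ (2 / 3 * (3 + `|C| * t) * t)).
  by rewrite ler_pM2r// ler_pM2l//.
have : `|C| * (4 * t) <= `|C| * t ^+ 3 by rewrite ler_wpM2l.
have : `|C| * t * 2 <= `|C| * t * t by rewrite ler_wpM2l// mulr_ge0// ltW.
nra.
Qed.

Lemma asymptotic_limit_connection C : - 3 < C ->
  asymptotic_to_pullback (instanton C) (limit_connection (R := R)).
Proof.
(* As [rho = 3 t], the summand 6 gives [t >= 2] and the other one gives [6 (2 + |C|) / t < eps]. *)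
move=> C3 eps eps0; exists (6 + 18 * (2 + `|C|) / eps) => x Yx x0 Mr.
pose s := 1 + normq x.2 ^+ 2; pose t := s `^ (1 / 3).
have s0 : 0 < s by rewrite ltr_pwDl// sqr_ge0.
have rt : rho x = 3 * t by [].
have ts : t ^+ 3 = s.
  have e3 : 1 / 3 * 3%:R = 1 :> R by lra.
  by rewrite -powR_mulrn ?powR_ge0// -powRrM e3 powRr1// ltW.
have C0 : 0 <= `|C| := normr_ge0 C.
have Me : 0 < 18 * (2 + `|C|) / eps by rewrite divr_gt0// mulr_gt0// ltr_pwDl.
have t2 : 2 <= t by rewrite rt in Mr; lra.
have t0 : 0 < t by lra.
have te : 6 * ((2 + `|C|) / t) < eps.
  rewrite mulrA ltr_pdivrMr// [ltRHS]mulrC -ltr_pdivrMr//.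
  have e18 : 18 * (2 + `|C|) / eps = 3 * (6 * (2 + `|C|) / eps).
    by rewrite !mulrA; congr (_ * _ / _); lra.
  by rewrite rt e18 in Mr; lra.
set K := `|2 / 3 - f_C C x * normq x.2 ^+ 2|.
have Kt : K <= (2 + `|C|) / t.
  rewrite /K /f_C -/s -/t -ts (_ : normq x.2 ^+ 2 = t ^+ 3 - 1); last by rewrite ts /s; lra.
  exact: instanton_coef_le.
have K0 : 0 <= K := normr_ge0 _.
have r0 : 0 < 3 * t by rewrite mulr_gt0.
(* The factor 6 covers the seven frame vectors: each contributes at most [2 K / rho], and 7 times 4
   is below 36. *)
apply: (le_lt_trans _ te); apply: (@le_trans _ _ (6 * K)); last by rewrite ler_pM2l.
rewrite rt mulrC -ler_pdivlMr//.
rewrite /norm_gcon; set S := (X in sup X).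
(* Without an orthonormal frame the supremum is that of the empty set, which is 0. *)
have [->|/set0P S0] := eqVneq S set0.
  by rewrite sup0 divr_ge0 ?(ltW r0)// mulr_ge0.
apply: ge_sup => // r [e [Te oe] ->].
have L0 : 0 <= 6 * K / (3 * t) by rewrite divr_ge0 ?(ltW r0)// mulr_ge0.
rewrite -(ger0_norm L0) -sqrtr_sqr ler_wsqrtr//.
apply: (@le_trans _ _ (\sum_(i < 7) (2 * K / (3 * t)) ^+ 2)).
  apply: ler_sum => i _.
  rewrite normq_instanton_sub_pullback// -/K.
  have := gcon_psi_le Yx (Te i) x0.
  rewrite oe eqxx rt /=; move: (normq _) (normq_ge0 (ev1 psi (proj x) ('D_(e i) proj x))).
  move=> P P0 h.
  (* On a unit vector [gcon_psi_le] gives [rho P <= 3 / 2]; the integer bound 2 suffices. *)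
  have {}h : (3 * t) * P <= 2.
    rewrite -(@ler_pXn2r _ 2) ?nnegrE ?mulr_ge0 ?(ltW r0)//; lra.
  rewrite ler_pXn2r ?nnegrE ?mulr_ge0 ?invr_ge0 ?(ltW r0)//.
  rewrite ler_pdivlMr// [2 * K]mulrC -mulrA ler_wpM2l// mulrC//.
rewrite sumr_const card_ord -!mulrA !exprMn.
have := sqr_ge0 (K / (3 * t)); rewrite exprMn.
by move: (K ^+ 2 * _) => Z Z0; rewrite -[leLHS]mulr_natl; lra.
Qed.

End Asymptotics.

Theorem theorem1p2 (R : realType) :
  exists At : diff_form (R := R) 1 quat,
    [/\ su2_connection At,
        hermitian_yang_mills At,
        ~ flat_connection At &
        forall C : R, - 3 < C -> asymptotic_to_pullback (instanton C) At].
Proof.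
exists limit_connection; split.
- exact: su2_limit_connection.
- exact: hermitian_yang_mills_limit_connection.
- exact: limit_connection_not_flat.
- exact: asymptotic_limit_connection.
Qed.
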